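(* (1) There is an algorithm that, for all integers $1\le k\le d$ and every finite set of vectors $V\subseteq\mathbb{R}^d$, finds an $\tilde O(k)$-spectral $k$-spanner of $V$ of size $\tilde O(k)$. In particular there are universal constants $C,c>0$ (independent of $d$, $k$, $V$) such that every finite $V\subseteq\mathbb{R}^d$ has a $\big(Ck(1+\log k)^c\big)$-spectral $k$-spanner $U\subseteq V$ with $|U|\le Ck(1+\log k)^c$. (2) Furthermore, for any $\epsilon>0$ and $k\le d$ there exists a set $V\subseteq\mathbb{R}^d$ of size $e^{\Omega(k^\epsilon)}$ such that any $k^{1-\epsilon}$-spectral $k$-spanner $U\subseteq V$ of $V$ must contain all vectors of $V$ (i.e. $U=V$). Here $\Omega$ is asymptotic in $k$: for each $\epsilon>0$ there are constants $c'>0$ and $k_0$ such that for all $k_0\le k\le d$ such a $V$ exists with $|V|\ge e^{c'k^{\epsilon}}$.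
   Context: For symmetric $A,B\in\mathbb{R}^{d\times d}$ and $1\le k\le d$, write $A\preceq_k B$ if $\langle A,\Pi\rangle\le\langle B,\Pi\rangle$ for every orthogonal projection matrix $\Pi$ onto a $(d-k+1)$-dimensional linear subspace of $\mathbb{R}^d$, where $\langle A,B\rangle=\mathrm{tr}(AB^\intercal)$ (so $\preceq_d$ is the Loewner order). For $V\subseteq\mathbb{R}^d$, a subset $U\subseteq V$ is an $\alpha$-spectral $k$-spanner of $V$ if for every $v\in V$ there is a probability distribution $\mu_v$ on $U$ with $vv^\intercal\preceq_k\alpha\cdot\mathbb{E}_{u\sim\mu_v}[uu^\intercal]$. The notation $\tilde O(k)$ hides logarithmic factors in $k$: it denotes a quantity at most $Ck(1+\log k)^c$ for universal constants $C,c>0$. *)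

(* Defs.v *)
From HB Require Import structures.
From mathcomp Require Import all_boot all_order all_algebra.
From mathcomp Require Import finmap.
From mathcomp Require Import reals sequences exp.

Set Implicit Arguments.
Unset Strict Implicit.
Unset Printing Implicit Defensive.

Import Order.TTheory GRing.Theory Num.Theory.
Local Open Scope ring_scope.

Definition mxdot (R : realType) (d : nat) (A B : 'M[R]_d) : R :=
  \tr (A *m B^T).

(* [\rank P] is the dimension of the subspace that [P] projects onto. *)
Definition orth_projection (R : realType) (d : nat) (P : 'M[R]_d) : Prop :=
  P^T = P /\ P *m P = P.

(* The order of [A] and [B] for symmetric matrices, 1 <= k <= d; outside that
   range of k the truncated subtraction makes it meaningless. *)
Definition le_k (R : realType) (d k : nat) (A B : 'M[R]_d) : Prop :=
  forall P : 'M[R]_d,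
    orth_projection P -> \rank P = (d - k + 1)%N -> mxdot A P <= mxdot B P.

(* A probability mass function on U; its values outside U are irrelevant. *)
Definition distr_on (R : realType) (d : nat) (U : {fset 'cV[R]_d})
    (mu : 'cV[R]_d -> R) : Prop :=
  (forall u, u \in U -> 0 <= mu u) /\ \sum_(u <- U) mu u = 1.

Definition second_moment (R : realType) (d : nat) (U : {fset 'cV[R]_d})
    (mu : 'cV[R]_d -> R) : 'M[R]_d :=
  \sum_(u <- U) mu u *: (u *m u^T).

Definition spectral_spanner (R : realType) (d : nat) (alpha : R) (k : nat)
    (V U : {fset 'cV[R]_d}) : Prop :=
  (U `<=` V)%fset /\
  forall v, v \in V ->
    exists2 mu : 'cV[R]_d -> R, distr_on U mu
      & le_k k (v *m v^T) (alpha *: second_moment U mu).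

Definition quasilin (R : realType) (C c : R) (k : nat) : R :=
  C * k%:R * (1 + ln k%:R) `^ c.

(* Algorithms on real inputs, in the style of the real RAM: while programs with
   exact field operations and comparisons, whose store is a finite binary tree
   with real numbers at its leaves.  [Nil] encodes both the empty list and the
   truth value false; any other tree counts as true.  The only numeric
   constants are 0 and 1, and a program does not depend on the size of its
   input. *)
Inductive data (R : realType) : Type :=
| Nil
| Num of R
| Node of data R & data R.
Arguments Nil {R}.

Inductive prim : Type :=
| PId | PNil | PFst | PSnd
| PZero | POne | PAdd | PSub | PMul | PDiv | PLe.

Inductive prog : Type :=
| Prim of prim
| Pair of prog & prog
| Seq of prog & prog
| If of prog & prog & prog
| While of prog & prog.

Section Semantics.
Variable R : realType.
Implicit Types x y z : data R.

Definition fstd x := if x is Node a _ then a else Nil.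
Definition sndd x := if x is Node _ b then b else Nil.
Definition numd x : R := if x is Num r then r else 0.
Definition truthy x : bool := if x is Nil then false else true.
Definition of_bool (b : bool) : data R := if b then Node Nil Nil else Nil.

(* Total by convention: binary operations read a pair of numbers, a non-number
   is read as 0, and division by 0 gives 0. *)
Definition prim_sem (o : prim) x : data R :=
  let a := numd (fstd x) in
  let b := numd (sndd x) in
  match o with
  | PId => x
  | PNil => Nil
  | PFst => fstd x
  | PSnd => sndd x
  | PZero => Num 0
  | POne => Num 1
  | PAdd => Num (a + b)
  | PSub => Num (a - b)
  | PMul => Num (a * b)
  | PDiv => Num (a / b)
  | PLe => of_bool (a <= b)
  end.

(* [run p x y]: program p, started on x, halts with result y.  The test of
   [If] and [While] reads the current store and leaves it unchanged. *)
Inductive run : prog -> data R -> data R -> Prop :=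
| run_prim o x : run (Prim o) x (prim_sem o x)
| run_pair p q x y z : run p x y -> run q x z -> run (Pair p q) x (Node y z)
| run_seq p q x y z : run p x y -> run q y z -> run (Seq p q) x z
| run_if_true t p q x b y :
    run t x b -> truthy b -> run p x y -> run (If t p q) x y
| run_if_false t p q x b y :
    run t x b -> ~~ truthy b -> run q x y -> run (If t p q) x y
| run_while_true t p x b y z :
    run t x b -> truthy b -> run p x y -> run (While t p) y z ->
    run (While t p) x z
| run_while_false t p x b :
    run t x b -> ~~ truthy b -> run (While t p) x x.

Definition enc_seq (s : seq (data R)) : data R := foldr (@Node R) Nil s.

Definition enc_vec (d : nat) (v : 'cV[R]_d) : data R :=
  enc_seq [seq Num (v i 0) | i <- enum 'I_d].

Definition enc_vecs (d : nat) (V : seq 'cV[R]_d) : data R :=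
  enc_seq [seq enc_vec v | v <- V].

Definition enc_input (d k : nat) (V : seq 'cV[R]_d) : data R :=
  Node (Num d%:R) (Node (Num k%:R) (enc_vecs V)).

End Semantics.

(* Main.v *)
Require Import Defs.
From HB Require Import structures.
From mathcomp Require Import all_boot all_order all_algebra perm.
From mathcomp Require Import finmap.
From mathcomp Require Import reals sequences exp.
From mathcomp Require Import ring lra zify.

Set Implicit Arguments.
Unset Strict Implicit.
Unset Printing Implicit Defensive.

Import Order.TTheory GRing.Theory Num.Theory.
Local Open Scope ring_scope.

(* Upper bound.  For a list S of vectors let B = sum u u^T over S and let e_j(B) be
   the j-th elementary symmetric function of its eigenvalues.  Choose S among all
   lists of length 2k drawn from V so as to maximise e_j(B), where j is the largest
   degree <= k at which this does not vanish identically.  Averaging the optimality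
   condition over all exchanges u -> v, u in S, gives g(v) <= e_j(B), where
   g(v) = e_j(B + v v^T) - e_j(B) = v^T G_j v and G_(j+1) + B G_j = e_j(B) I.
   Hence e_j v = B G_j v + G_(j+1) v; both parts are bounded after projecting by P,
   the second one through G_(j+1) <= tr(P B) G_j, valid for P of corank < j.  This
   yields |P v|^2 <= 4 tr(P B), so the uniform distribution on S spans V with factor
   8k.  The algorithm is exhaustive search: e_j(B) satisfies
   e_j(u :: S) = e_j(S) + |u|^2 e_(j-1)(S projected off u), which needs only field
   operations.

   Lower bound.  For eps <= 1 a maximal packing of the sign vectors in R^k has
   exp(Omega(k^eps)) elements with |<x, y>| < k^((1+eps)/2)/2; the projection onto a
   sign vector x and the last d - k coordinates sees x but hardly any other vector.
   For eps > 1 the factor is < 1 and multiples of one vector have no spanner. *)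

(** * Coefficients of [det (1 + x A)] *)

Section DetIdentities.

(** Sylvester's identity: the block matrix [M] factors in two ways into block triangular matrices,
    and each side is the determinant of one product. *)
Lemma det_1addmxC (R : comNzRingType) m n (A : 'M[R]_(m, n)) (B : 'M[R]_(n, m)) :
  \det (1%:M + A *m B) = \det (1%:M + B *m A).
Proof.
pose M := block_mx 1%:M (- A) B 1%:M.
have /(congr1 determinant) : M = block_mx 1%:M 0 B 1%:M *m
                             block_mx 1%:M (- A) 0 (1%:M + B *m A).
  by rewrite mulmx_block !(mulmx0, mul0mx, mul1mx, mulmx1, addr0, add0r)
    mulmxN [1%:M + _]addrC addKr.
have /(congr1 determinant) : M = block_mx (1%:M + A *m B) (- A) 0 1%:M *m
                             block_mx 1%:M 0 B 1%:M.
  by rewrite mulmx_block !(mulmx0, mul0mx, mul1mx, mulmx1, addr0, add0r)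
    mulNmx addrK.
by rewrite !det_mulmx !det_ublock !det_lblock !det1 !mul1r !mulr1 => -> ->.
Qed.

(* The polynomial identity behind Sherman-Morrison; [a] is cancelled, so no
   inverse of [M] is needed. *)
Lemma det_add_rank1 (R : idomainType) n (M : 'M[R]_n) (v : 'cV_n) (w : 'rV_n) :
  \det M != 0 ->
  \det (M + v *m w) = \det M + (w *m \adj M *m v) 0 0.
Proof.
set a := \det M => a0; pose y := \adj M *m v.
have h1 : a ^+ n * \det (M + v *m w) = a * \det (a%:M + y *m w).
  rewrite -detZ -det_mulmx mulmxDr scalerDr -mul_mx_scalar; congr (\det (_ + _)).
  by rewrite mulmxA /y mulmxA mul_mx_adj mul_scalar_mx scalemxAl.
have h2 : \det (a%:M + y *m w) * a = (a + (w *m y) 0 0) * a ^+ n.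
  have /(congr1 determinant) :
      block_mx 1%:M (- w) y a%:M *m block_mx a%:M 0 (- y) 1%:M =
      block_mx (a%:M + w *m y) (- w) 0 a%:M.
    rewrite mulmx_block !(mulmx0, mul0mx, mul1mx, mulmx1, addr0, add0r).
    rewrite mulNmx mulmxN opprK; congr block_mx.
    by rewrite mul_mx_scalar mulmxN mul_scalar_mx subrr.
  rewrite det_mulmx det_ublock det_lblock !det_scalar !expr1n mulr1 [\det (_ + w *m y)]det_mx11.
  rewrite !mxE eqxx mulr1n => <-; congr (_ * _).
  have -> : block_mx 1%:M (- w) y a%:M = block_mx 1%:M 0 y 1%:M *m
             block_mx 1%:M (- w) 0 (a%:M + y *m w).
    by rewrite mulmx_block !(mulmx0, mul0mx, mul1mx, mulmx1, addr0, add0r)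
      mulmxN addrC addrK.
  by rewrite det_mulmx det_ublock det_lblock !det1 !mul1r.
by apply: (mulfI (expf_neq0 n a0)); rewrite h1 mulrC h2 mulrC -mulmxA.
Qed.

End DetIdentities.

(** * Elementary symmetric functions of the eigenvalues and their derivatives *)

Section CharCoef.
Variable R : realFieldType.

(** The reversed characteristic polynomial of [- A]. Its constant coefficient is 1, so it is nonzero
    for every [A], as [det_add_rank1] requires. *)
Definition rev_char n (A : 'M[R]_n) : {poly R} :=
  \det (1%:M + 'X *: map_mx polyC A).

(* The [j]-th elementary symmetric function of the eigenvalues. *)
Definition esp j n (A : 'M[R]_n) : R := (rev_char A)`_j.

(* The quadratic form [grad j] is the derivative of [esp j]; [grad j.+1] is the
   coefficient of ['X^j] in the adjugate of [1 + X A]. *)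
Fixpoint grad j n (A : 'M[R]_n) : 'M[R]_n :=
  if j is i.+1 then (esp i A)%:M - A *m grad i A else 0.

Definition qf n (A : 'M[R]_n) (v : 'cV_n) : R := (v^T *m A *m v) 0 0.

Definition sqn n (v : 'cV[R]_n) : R := (v^T *m v) 0 0.

(* The projection off [u]; as [0^-1 = 0], this is the identity when [u] is 0. *)
Definition perp n (u : 'cV[R]_n) : 'M[R]_n := 1%:M - (sqn u)^-1 *: (u *m u^T).

Lemma esp0 n (A : 'M_n) : esp 0 A = 1.
Proof.
rewrite /esp /rev_char -horner_coef0 -horner_evalE -det_map_mx.
rewrite (_ : map_mx _ _ = 1%:M) ?det1 //.
by apply/matrixP => i j; rewrite !mxE /= horner_evalE !hornerE hornerMn !hornerE.
Qed.

Lemma rev_char_neq0 n (A : 'M_n) : rev_char A != 0.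
Proof. by apply/negP => /eqP h; have := esp0 A; rewrite /esp h coef0 => /eqP; rewrite eq_sym oner_eq0. Qed.

Lemma rev_charC m n (A : 'M_(m, n)) (B : 'M_(n, m)) :
  rev_char (A *m B) = rev_char (B *m A).
Proof.
rewrite /rev_char !map_mxM /= scalemxAl det_1addmxC.
by rewrite -scalemxAr.
Qed.

Lemma espC j m n (A : 'M_(m, n)) (B : 'M_(n, m)) :
  esp j (A *m B) = esp j (B *m A).
Proof. by rewrite /esp rev_charC. Qed.

(** Comparing coefficients in [M *m \adj M = (\det M)%:M] for [M] = 1 + X A yields the recursion
    that defines [grad]. *)
Lemma coefp_adj j n (A : 'M_n) :
  map_mx (coefp j) (\adj (1%:M + 'X *: map_mx polyC A)) = grad j.+1 A.
Proof.
set M := 1%:M + _.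
have H : \adj M + 'X *: (map_mx polyC A *m \adj M) = (rev_char A)%:M.
  by rewrite -(mul_mx_adj M) /M mulmxDl mul1mx scalemxAl.
have C i : map_mx (coefp i) (map_mx polyC A *m \adj M) =
           A *m map_mx (coefp i) (\adj M).
  apply/matrixP => a b; rewrite !mxE /= coef_sum.
  by apply: eq_bigr => l _; rewrite !mxE coefCM.
elim: j => [|j IH]; move/matrixP: H => H; apply/matrixP => a b.
  rewrite /= mulmx0 subr0 !mxE /=; have := congr1 (coefp 0) (H a b).
  by rewrite !mxE /= coefD coefXM /= addr0 coefMn => ->.
rewrite [grad _ _]/= -[X in _ - A *m X]/(grad j.+1 A) -IH -C !mxE /=.
have := congr1 (coefp j.+1) (H a b).
by rewrite !mxE /= coefD coefXM /= coefMn /esp => <-; rewrite addrK.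
Qed.

Lemma grad_tr j n (A : 'M_n) : A^T = A -> (grad j A)^T = grad j A.
Proof.
move=> hA; case: j => [|j]; first by rewrite trmx0.
rewrite -coefp_adj map_trmx trmx_adj; congr (map_mx _ (\adj _)).
by rewrite linearD /= linearZ /= trmx1 map_trmx hA.
Qed.

Lemma qf_adj j n (A : 'M_n) (u w : 'cV_n) :
  ((map_mx polyC w^T *m \adj (1%:M + 'X *: map_mx polyC A)
    *m map_mx polyC u) 0 0)`_j = (w^T *m grad j.+1 A *m u) 0 0.
Proof.
rewrite -coefp_adj !mxE coef_sum; apply: eq_bigr => a _.
rewrite !mxE coefMC coef_sum; congr (_ * _); apply: eq_bigr => b _.
by rewrite !mxE coefCM.
Qed.

(** [det_add_rank1] over the polynomial ring: a rank-one update changes [esp] exactly linearly in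
    [c], without higher-order terms. *)
Lemma esp_add_rank1 j n (A : 'M_n) c (u : 'cV_n) :
  esp j (A + c *: (u *m u^T)) = esp j A + c * qf (grad j A) u.
Proof.
case: j => [|j].
  by rewrite !esp0 /= /qf mulmx0 mul0mx mxE mulr0 addr0.
have {1}-> : esp j.+1 (A + c *: (u *m u^T)) =
   (\det (1%:M + 'X *: map_mx polyC A +
     (c%:P *: map_mx polyC u) *m ('X *: map_mx polyC u^T)) : {poly R})`_j.+1.
  rewrite /esp /rev_char; congr ((\det _ : {poly R})`_ _).
  rewrite map_mxD scalerDr addrA; congr (_ + _).
  by rewrite map_mxZ map_mxM /= -scalemxAr -scalemxAl.
rewrite det_add_rank1 ?rev_char_neq0 // coefD; congr (_ + _).
rewrite -scalemxAr -!scalemxAl mxE mxE coefCM; congr (_ * _).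
by rewrite coefXM /= qf_adj.
Qed.

Lemma sqnE n (u : 'cV_n) : sqn u = \sum_i u i 0 ^+ 2.
Proof. by rewrite /sqn !mxE; apply: eq_bigr => i _; rewrite !mxE expr2. Qed.

Lemma sqn_ge0 n (u : 'cV_n) : 0 <= sqn u.
Proof. by rewrite sqnE; apply: sumr_ge0 => i _; rewrite sqr_ge0. Qed.

Lemma sqn_eq0 n (u : 'cV_n) : sqn u = 0 -> u = 0.
Proof.
rewrite sqnE => /eqP; rewrite psumr_eq0 => [/allP h|i _]; last exact: sqr_ge0.
apply/matrixP => i j; rewrite ord1 mxE; apply/eqP.
by have := h i (mem_index_enum i); rewrite sqrf_eq0.
Qed.

Lemma perp_tr n (u : 'cV_n) : (perp u)^T = perp u.
Proof. by rewrite /perp linearB /= linearZ /= trmx1 trmx_mul trmxK. Qed.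

Lemma sqnM n (u : 'cV_n) : u^T *m u = (sqn u)%:M.
Proof. by rewrite [LHS]mx11_scalar. Qed.

Lemma perp_self n (u : 'cV_n) : perp u *m u = 0.
Proof.
have [/sqn_eq0->|h] := eqVneq (sqn u) 0; first by rewrite mulmx0.
rewrite /perp mulmxBl mul1mx -scalemxAl -mulmxA sqnM mul_mx_scalar scalerA.
by rewrite mulVf // scale1r subrr.
Qed.

Lemma perp_idem n (u : 'cV_n) : perp u *m perp u = perp u.
Proof.
by rewrite {2}/perp mulmxBr mulmx1 -scalemxAr mulmxA perp_self mul0mx scaler0 subr0.
Qed.

(** The source of all positivity below: differentiating along u u^T amounts to compressing [A] to
    the complement of [u]. As [perp u *m A] differs from [A] by a rank-one matrix, [det_add_rank1]
    computes its [rev_char]. *)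
Lemma qf_grad j n (A : 'M_n) (u : 'cV_n) :
  qf (grad j.+1 A) u = sqn u * esp j (perp u *m A).
Proof.
have [h|h] := eqVneq (sqn u) 0.
  by rewrite h (sqn_eq0 h) /qf mulmx0 mxE mul0r.
set M := 1%:M + 'X *: map_mx polyC A.
pose q := (map_mx polyC u^T *m \adj M *m map_mx polyC u) 0 0.
have -> : qf (grad j.+1 A) u = q`_j by rewrite /q qf_adj.
suff -> : q = (sqn u)%:P * rev_char (perp u *m A) by rewrite coefCM.
have -> : rev_char (perp u *m A) =
  \det (M + (- (sqn u)^-1%:P *: map_mx polyC u) *m ('X *: map_mx polyC (u^T *m A))).
  rewrite /rev_char; congr (\det _); rewrite /M -addrA; congr (_ + _).
  rewrite /perp mulmxBl mul1mx map_mxB scalerBr; congr (_ + _).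
  rewrite -[_ *: _ *m A]scalemxAl map_mxZ -mulmxA !map_mxM /= -scalemxAr -scalemxAl.
  by rewrite scaleNr scalerN.
rewrite det_add_rank1 ?rev_char_neq0 // -!scalemxAl -scalemxAr map_mxM /=.
have -> : 'X *: (- (sqn u)^-1%:P *: (map_mx polyC u^T *m map_mx polyC A *m \adj M
     *m map_mx polyC u)) =
   (- (sqn u)^-1%:P) *: (((sqn u)%:P * rev_char A)%:M - q%:M).
  rewrite scalerA mulrC -scalerA; congr (_ *: _).
  have -> : q%:M = map_mx polyC u^T *m \adj M *m map_mx polyC u.
    by rewrite [RHS]mx11_scalar.
  have -> : ((sqn u)%:P * rev_char A)%:M =
     map_mx polyC u^T *m (rev_char A)%:M *m map_mx polyC u.
    rewrite -scalemx1 mulrC -scalerA scalemx1 -map_scalar_mx -sqnM map_mxM.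
    by rewrite mul_mx_scalar scalemxAl.
  have -> : (rev_char A)%:M = \adj M + 'X *: (map_mx polyC A *m \adj M).
    by rewrite -[rev_char A]/(\det M) -(mul_mx_adj M) {1}/M mulmxDl mul1mx scalemxAl.
  rewrite mulmxDr mulmxDl addrAC subrr add0r.
  by rewrite -scalemxAr -scalemxAl !mulmxA.
rewrite !mxE eqxx !mulr1n -[\det M]/(rev_char A).
have hc : (sqn u)%:P * (sqn u)^-1%:P = 1 :> {poly R} by rewrite -polyCM divff.
by rewrite mulNr mulrBr mulrA hc mul1r opprB addrC subrK.
Qed.

End CharCoef.

(** * Bounds for Gram matrices *)

Section Gram.
Variable R : realFieldType.

Lemma sqnZ n a (u : 'cV[R]_n) : sqn (a *: u) = a ^+ 2 * sqn u.
Proof. by rewrite !sqnE mulr_sumr; apply: eq_bigr => i _; rewrite mxE exprMn. Qed.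

Lemma gram_row_mx d m n (U : 'M[R]_(d, m)) (W : 'M_(d, n)) :
  row_mx U W *m (row_mx U W)^T = U *m U^T + W *m W^T.
Proof. by rewrite tr_row_mx mul_row_col. Qed.

Lemma gram_split d n (U : 'M[R]_(d, n.+1)) :
  exists (y : 'cV_d) (W : 'M_(d, n)), U *m U^T = y *m y^T + W *m W^T.
Proof.
exists (lsubmx (U : 'M_(d, 1 + n))), (rsubmx (U : 'M_(d, 1 + n))).
by rewrite -gram_row_mx hsubmxK.
Qed.

Lemma gram_tr d n (U : 'M[R]_(d, n)) : (U *m U^T)^T = U *m U^T.
Proof. by rewrite trmx_mul trmxK. Qed.

Lemma esp_perpM d n (U : 'M[R]_(d, n)) j (u : 'cV_d) :
  esp j (perp u *m (U *m U^T)) = esp j ((perp u *m U) *m (perp u *m U)^T).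
Proof.
by rewrite -perp_idem -mulmxA espC perp_idem trmx_mul perp_tr !mulmxA.
Qed.

Lemma esp_mx0 j n : esp j (0 : 'M[R]_n) = (j == 0%N)%:R.
Proof. by rewrite /esp /rev_char map_mx0 scaler0 addr0 det1 coef1. Qed.

Lemma esp_add_sqr j n (A : 'M[R]_n) (u : 'cV_n) :
  esp j.+1 (A + u *m u^T) = esp j.+1 A + sqn u * esp j (perp u *m A).
Proof. by rewrite -[u *m u^T]scale1r esp_add_rank1 mul1r qf_grad. Qed.

(** Splitting off a column [y] leaves two Gram matrices with one column fewer, the second projected
    off [y], so induction on the number of columns applies. *)
Lemma esp_gram_ge0 d n (U : 'M[R]_(d, n)) j : 0 <= esp j (U *m U^T).
Proof.
elim: n U j => [|n IH] U j; first by rewrite [U]thinmx0 mul0mx esp_mx0 ler0n.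
case: j => [|j]; first by rewrite esp0 ler01.
have [y [W ->]] := gram_split U; rewrite addrC esp_add_sqr esp_perpM.
by rewrite addr_ge0 ?mulr_ge0 ?sqn_ge0.
Qed.

Lemma grad_gram_ge0 d n (U : 'M[R]_(d, n)) j u : 0 <= qf (grad j (U *m U^T)) u.
Proof.
case: j => [|j]; first by rewrite /qf /= mulmx0 mul0mx mxE.
by rewrite qf_grad esp_perpM mulr_ge0 ?sqn_ge0 ?esp_gram_ge0.
Qed.

(** By cyclicity the projection subtracts a nonnegative rank-one term from U^T U, and the derivative
    of [esp] at a Gram matrix is nonnegative. *)
Lemma esp_perp_le d n (U : 'M[R]_(d, n)) j u :
  esp j (perp u *m (U *m U^T)) <= esp j (U *m U^T).
Proof.
rewrite mulmxA espC mulmxA /perp mulmxBr mulmx1 mulmxBl -scalemxAr -scalemxAl.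
have -> : U^T *m (u *m u^T) *m U = (U^T *m u) *m (U^T *m u)^T.
  by rewrite trmx_mul trmxK !mulmxA.
rewrite -scaleNr esp_add_rank1 [esp j (U *m _)]espC -[in leRHS](trmxK U).
rewrite -{1 2}[U in U^T *m U](trmxK U) trmxK mulNr gerDl oppr_le0.
rewrite mulr_ge0 ?invr_ge0 ?sqn_ge0 //.
by rewrite -{2}(trmxK U) grad_gram_ge0.
Qed.

Lemma mxtrace_gram_ge0 d n (U : 'M[R]_(d, n)) : 0 <= \tr (U *m U^T).
Proof.
by apply: sumr_ge0 => i _; rewrite !mxE; apply: sumr_ge0 => l _;
  rewrite !mxE -expr2 sqr_ge0.
Qed.

(** Adding the columns of [W] one at a time, each [y] raises the left side by [sqn y] times a
    compressed [esp j], which [esp_perp_le] bounds; [sqn y] is its share of the trace. *)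
Lemma esp_le_trace d m p (W : 'M[R]_(d, m)) (V : 'M_(d, p)) j :
  esp j.+1 (V *m V^T) = 0 ->
  esp j.+1 (W *m W^T + V *m V^T) <=
    \tr (W *m W^T) * esp j (W *m W^T + V *m V^T).
Proof.
move=> V0; elim: m W => [|m IH] W.
  by rewrite [W]thinmx0 mul0mx add0r V0 linear0 mul0r.
have [y [W' ->]] := gram_split W; rewrite -addrA addrC.
have BE : W' *m W'^T + V *m V^T = row_mx W' V *m (row_mx W' V)^T.
  by rewrite gram_row_mx.
have mono : esp j (W' *m W'^T + V *m V^T) <= esp j (W' *m W'^T + V *m V^T + y *m y^T).
  rewrite -[y *m y^T]scale1r esp_add_rank1 mul1r lerDl BE; exact: grad_gram_ge0.
rewrite esp_add_sqr [leLHS]addrC mxtraceD mulrDl.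
have -> : \tr (y *m y^T) = sqn y.
  by rewrite mxtrace_mulC sqnM mxtrace_scalar mulr1n.
rewrite lerD //.
  rewrite ler_wpM2l ?sqn_ge0 //; apply: le_trans mono.
  by rewrite BE esp_perp_le.
apply: le_trans (IH W') _; rewrite ler_wpM2l //.
exact: mxtrace_gram_ge0.
Qed.

Lemma esp_gt_size j n (A : 'M[R]_n) : (n < j)%N -> esp j A = 0.
Proof.
move=> nj; apply: nth_default; apply: leq_trans nj.
rewrite /rev_char; apply: (leq_trans (size_sum _ _ _)).
apply/bigmax_leqP => s _; rewrite -signr_odd.
have szs (b : bool) (q : {poly R}) : size ((-1) ^+ b * q) = size q.
  by case: b; rewrite ?expr0 ?expr1 ?mulN1r ?size_polyN ?mul1r.
rewrite szs; apply: leq_trans (size_prod_leq _ _) _.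
have : (\sum_(i < n) size ((1%:M + 'X *: map_mx polyC A : 'M[{poly R}]_n)%R i ((s : 'S_n) i)) <= \sum_(i < n) 2)%N.
  apply: leq_sum => i _; rewrite !mxE.
  apply: leq_trans (size_polyD _ _) _; rewrite geq_max; apply/andP; split.
    by case: eqP; rewrite ?size_poly1 ?size_poly0.
  by rewrite mulrC mul_polyC; apply: leq_trans (size_scale_leq _ _) _; rewrite size_polyX.
rewrite sum_nat_const card_ord muln2 -addnn => h.
by rewrite leq_subLR addnS ltnS; exact: h.
Qed.

Lemma esp_gt_rank j n (A : 'M[R]_n) : (\rank A < j)%N -> esp j A = 0.
Proof. by move=> h; rewrite -(mulmx_base A) espC esp_gt_size. Qed.

Lemma qfB n (G : 'M[R]_n) a v x : G^T = G ->
  qf G (v - a *: x) = qf G v - 2 * a * (x^T *m G *m v) 0 0 + a ^+ 2 * qf G x.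
Proof.
move=> Gs; rewrite /qf.
have -> : (v - a *: x)^T = v^T - a *: x^T by rewrite linearB /= linearZ.
rewrite !mulmxBl !mulmxBr -!scalemxAl -!scalemxAr -[in v^T *m G *m x]Gs.
have -> : v^T *m G^T *m x = (x^T *m G *m v)^T by rewrite !trmx_mul trmxK mulmxA.
by move: (v^T *m G *m v) (x^T *m G *m v) (x^T *m G *m x) => p q r; rewrite !mxE; ring.
Qed.

(** Replacing [U] by [U *m perp b] subtracts a multiple of (U b)(U b)^T from the Gram matrix; [esp]
    stays nonnegative, and its linearity turns this into the bound. *)
Lemma grad_image_le d n (U : 'M[R]_(d, n)) j (b : 'cV_n) :
  qf (grad j (U *m U^T)) (U *m b) <= esp j (U *m U^T) * sqn b.
Proof.
have [h|h] := eqVneq (sqn b) 0.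
  by rewrite h (sqn_eq0 h) mulmx0 /qf mulmx0 mxE mulr0.
have s0 : 0 < sqn b by rewrite lt_def h sqn_ge0.
have := esp_gram_ge0 (U *m perp b) j.
rewrite trmx_mul perp_tr mulmxA -[U *m _ *m _]mulmxA perp_idem.
rewrite /perp mulmxBr mulmx1 mulmxBl -scalemxAr -scalemxAl.
have -> : U *m (b *m b^T) *m U^T = (U *m b) *m (U *m b)^T.
  by rewrite trmx_mul !mulmxA.
rewrite -scaleNr esp_add_rank1 mulNr subr_ge0 => h1.
by rewrite -ler_pdivrMr // mulrC.
Qed.

(** The form [G] is nonnegative at [v] - e^-1 U b with [b] = U^T G v; [grad_image_le] controls the
    quadratic term. *)
Lemma grad_cauchy_schwarz d n (U : 'M[R]_(d, n)) j v : 0 < esp j (U *m U^T) ->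
  sqn (U^T *m grad j (U *m U^T) *m v)
    <= esp j (U *m U^T) * qf (grad j (U *m U^T)) v.
Proof.
set e := esp _ _; set G := grad _ _ => e0; set b := _ *m v.
have := grad_gram_ge0 U j (v - e^-1 *: (U *m b)); rewrite -/G.
rewrite qfB; last by rewrite grad_tr ?gram_tr.
have -> : ((U *m b)^T *m G *m v) 0 0 = sqn b by rewrite /sqn {2}/b trmx_mul !mulmxA.
have := grad_image_le U j b; rewrite -/G -/e => h1 h2.
have h3 : e^-1 ^+ 2 * qf G (U *m b) <= e^-1 * sqn b.
  rewrite expr2 -mulrA ler_wpM2l ?invr_ge0 ?(ltW e0) //.
  by rewrite mulrC ler_pdivrMr // mulrC.
by rewrite mulrC -ler_pdivrMr // mulrC; lra.
Qed.

(** The same step with [b] = G v; here G is at most e times the identity by [qf_grad] and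
    [esp_perp_le]. *)
Lemma grad_succ_cauchy_schwarz d n (U : 'M[R]_(d, n)) j v : 0 < esp j (U *m U^T) ->
  sqn (grad j.+1 (U *m U^T) *m v)
    <= esp j (U *m U^T) * qf (grad j.+1 (U *m U^T)) v.
Proof.
set e := esp _ _; set G := grad _ _ => e0; set b := _ *m v.
have Gs : G^T = G by rewrite grad_tr ?gram_tr.
have := grad_gram_ge0 U j.+1 (v - e^-1 *: b); rewrite -/G.
rewrite qfB //.
have -> : (b^T *m G *m v) 0 0 = sqn b by rewrite /sqn {2}/b !mulmxA.
have h1 : qf G b <= e * sqn b.
  by rewrite /G qf_grad mulrC ler_wpM2r ?sqn_ge0 ?esp_perp_le.
move=> h2; have h3 : e^-1 ^+ 2 * qf G b <= e^-1 * sqn b.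
  rewrite expr2 -mulrA ler_wpM2l ?invr_ge0 ?(ltW e0) //.
  by rewrite mulrC ler_pdivrMr // mulrC.
by rewrite mulrC -ler_pdivrMr // mulrC; lra.
Qed.

(** By [qf_grad] both sides concern the Gram matrix compressed to the complement of [v]. That
    complement splits into its intersection with the range of [P] and a rest of dimension at most
    [j]; [esp j.+1] vanishes on the rest, so [esp_le_trace] applies. *)
Lemma grad_succ_le_trace d n (U : 'M[R]_(d, n)) j v (P : 'M_d) :
  P^T = P -> P *m P = P -> (\rank (1%:M - P)%R <= j)%N ->
  qf (grad j.+2 (U *m U^T)) v
    <= \tr (U^T *m P *m U) * qf (grad j.+1 (U *m U^T)) v.
Proof.
move=> Pt Pi Pr; rewrite !qf_grad [leRHS]mulrCA ler_wpM2l ?sqn_ge0 //.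
(* [P2] projects onto the vectors in the range of [P] orthogonal to [v], and [N] onto the rest of
   the complement of [v]. *)
pose y := P *m v; pose c := (sqn y)^-1; pose P2 := P - c *: (y *m y^T).
pose N := perp v - P2.
have Py : P *m y = y by rewrite mulmxA Pi.
have yP : y^T *m P = y^T by rewrite -{1}Pt -trmx_mul Py.
have P2E : P2 = perp y *m P.
  by rewrite /perp mulmxBl mul1mx -scalemxAl -mulmxA yP.
have P2E' : P2 = P *m perp y.
  by rewrite /perp mulmxBr mulmx1 -scalemxAr mulmxA Py.
have P2t : P2^T = P2 by rewrite P2E trmx_mul perp_tr Pt -P2E'.
have P2i : P2 *m P2 = P2.
  by rewrite {1}P2E' P2E mulmxA -(mulmxA P) perp_idem -P2E' P2E -mulmxA Pi.
have P2v : P2 *m v = 0 by rewrite P2E -mulmxA perp_self.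
have P2p : P2 *m perp v = P2.
  by rewrite /perp mulmxBr mulmx1 -scalemxAr mulmxA P2v mul0mx scaler0 subr0.
have pP2 : perp v *m P2 = P2 by apply: trmx_inj; rewrite trmx_mul perp_tr P2t.
have Nt : N^T = N by rewrite /N linearB /= perp_tr P2t.
have Ni : N *m N = N.
  by rewrite /N (mulmxBr _ (perp v)) !(mulmxBl (perp v)) perp_idem pP2 P2p P2i subrr subr0.
(* A factorization through [1%:M - P] bounds the rank of [N]. *)
have NE : N = perp v *m (1%:M - P) *m (1%:M - c *: (v *m y^T)).
  rewrite -mulmxA.
  have -> : (1%:M - P) *m (1%:M - c *: (v *m y^T)) =
            1%:M - P2 - c *: (v *m y^T) :> 'M_d.
    rewrite mulmxBr mulmx1 -scalemxAr mulmxA mulmxBl mul1mx -/y mulmxBl scalerBr.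
    by rewrite /P2 !opprD !opprK !addrA [RHS]addrAC.
  by rewrite (mulmxBr (perp v) (1%:M - P2)) (mulmxBr (perp v) 1%:M) mulmx1 -scalemxAr mulmxA perp_self mul0mx
    scaler0 subr0 pP2.
have Nr : (\rank N <= j)%N.
  rewrite NE; apply: leq_trans Pr; apply: leq_trans (mxrankM_maxl _ _) _.
  exact: mxrankM_maxr.
have gramQ (Q : 'M_d) : Q^T = Q -> Q *m Q = Q ->
    U^T *m Q *m U = (U^T *m Q) *m (U^T *m Q)^T.
  by move=> Qt Qi; rewrite trmx_mul trmxK Qt !mulmxA -[_ *m Q *m Q]mulmxA Qi.
have KE i : esp i (perp v *m (U *m U^T)) =
   esp i ((U^T *m P2) *m (U^T *m P2)^T + (U^T *m N) *m (U^T *m N)^T).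
  rewrite -!gramQ // -mulmxDl -mulmxDr [P2 + N]addrC subrK mulmxA espC.
  by rewrite mulmxA.
rewrite !KE.
have K0 : esp j.+1 ((U^T *m N) *m (U^T *m N)^T) = 0.
  rewrite esp_gt_rank // ltnS; apply: leq_trans Nr.
  by apply: leq_trans (mxrankM_maxl _ _) _; exact: mxrankM_maxr.
apply: le_trans (esp_le_trace _ K0) _; rewrite -KE.
apply: ler_wpM2r; first by rewrite esp_perpM esp_gram_ge0.
(* [P - P2] is positive semidefinite, so the trace through [P2] is at most that through [P]. *)
rewrite -gramQ // /P2 mulmxBr mulmxBl raddfB /= gerBl -scalemxAr -scalemxAl.
rewrite mxtraceZ mulr_ge0 ?invr_ge0 ?sqn_ge0 //.
have -> : U^T *m (y *m y^T) *m U = (U^T *m y) *m (U^T *m y)^T.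
  by rewrite [(U^T *m y)^T]trmx_mul trmxK !mulmxA.
exact: mxtrace_gram_ge0.
Qed.

Lemma sqnD_le n (u w : 'cV[R]_n) : sqn (u + w) <= 2 * sqn u + 2 * sqn w.
Proof.
rewrite !sqnE !mulr_sumr -big_split /=; apply: ler_sum => i _; rewrite !mxE.
by have := sqr_ge0 (u i 0 - w i 0); nra.
Qed.

(** The operator norm is at most the Hilbert-Schmidt norm: the Gram matrix of [A *m perp b] has
    nonnegative trace. *)
Lemma sqn_mulmx_le m n (A : 'M[R]_(m, n)) (b : 'cV_n) :
  sqn (A *m b) <= \tr (A^T *m A) * sqn b.
Proof.
have [h|h] := eqVneq (sqn b) 0.
  by rewrite h (sqn_eq0 h) mulmx0 mulr0 sqnE big1 // => i _; rewrite mxE expr0n.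
have := mxtrace_gram_ge0 (A *m perp b).
rewrite trmx_mul perp_tr mulmxA -[A *m _ *m _]mulmxA perp_idem.
rewrite -mulmxA mxtrace_mulC -mulmxA mxtrace_mulC /perp mulmxBr mulmx1.
rewrite raddfB /= subr_ge0 -scalemxAr mxtraceZ mulmxA mxtrace_mulC !mulmxA.
rewrite [b^T *m A^T *m A *m b]mx11_scalar mxtrace_scalar mulr1n.
rewrite mulrC ler_pdivrMr ?lt_def ?h ?sqn_ge0 //.
by rewrite /sqn trmx_mul !mulmxA.
Qed.

Lemma sqn_proj_le n (P : 'M[R]_n) (v : 'cV_n) :
  P^T = P -> P *m P = P -> sqn (P *m v) <= sqn v.
Proof.
move=> Pt Pi; have := sqn_ge0 (v - P *m v).
have hP : (v - P *m v)^T = v^T - v^T *m P by rewrite linearB /= trmx_mul Pt.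
have hS : sqn (P *m v) = (v^T *m P *m v) 0 0.
  by rewrite /sqn trmx_mul Pt mulmxA -[v^T *m P *m P]mulmxA Pi.
rewrite {1}/sqn hP mulmxBl !mulmxBr !mulmxA -[v^T *m P *m P]mulmxA Pi subrr subr0.
by rewrite hS /sqn mxE [X in _ + X]mxE subr_ge0.
Qed.

(* [e v = B G v + G' v] splits [v] into a combination of the columns of [U] and a
   remainder; each part is controlled by [qf G v <= e]. *)
Lemma proj_le_trace d n (U : 'M[R]_(d, n)) j v (P : 'M_d) :
  P^T = P -> P *m P = P ->
  0 < esp j (U *m U^T) ->
  qf (grad j (U *m U^T)) v <= esp j (U *m U^T) ->
  (\rank (1%:M - P)%R < j)%N \/ qf (grad j.+1 (U *m U^T)) v <= 0 ->
  sqn (P *m v) <= 4 * \tr (U^T *m P *m U).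
Proof.
move=> Pt Pi; set B := U *m U^T; set e := esp j B => e0 ge hr.
set t := \tr _.
pose b := U^T *m grad j B *m v; pose r := grad j.+1 B *m v.
have t0 : 0 <= t.
  suff -> : t = \tr ((U^T *m P) *m (U^T *m P)^T) by apply: mxtrace_gram_ge0.
  by rewrite trmx_mul trmxK Pt !mulmxA -[_ *m P *m P]mulmxA Pi.
have hv : e *: v = U *m b + r.
  by rewrite /r /= mulmxBl mul_scalar_mx /b !mulmxA addrC subrK.
have g0 : 0 <= qf (grad j B) v by exact: grad_gram_ge0.
have hb : sqn b <= e ^+ 2.
  rewrite expr2; apply: le_trans (grad_cauchy_schwarz v e0) _.
  by rewrite ler_wpM2l ?(ltW e0).
have hr' : sqn r <= e ^+ 2 * t.
  apply: le_trans (grad_succ_cauchy_schwarz v e0) _.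
  rewrite expr2 -mulrA ler_wpM2l ?(ltW e0) //.
  case: hr => [|h]; last by apply: le_trans h _; rewrite mulr_ge0 ?(ltW e0).
  rewrite /e /B /t; move: ge; rewrite /e /B.
  case: (j) => [//|i] ge; rewrite ltnS => hr.
  apply: le_trans (grad_succ_le_trace _ _ Pt Pi hr) _.
  by rewrite mulrC ler_wpM2r.
have hPb : sqn (P *m (U *m b)) <= t * sqn b.
  rewrite mulmxA; apply: le_trans (sqn_mulmx_le _ _) _.
  by rewrite trmx_mul Pt mulmxA -[_ *m P *m P]mulmxA Pi.
(* Both parts are at most [e ^+ 2 * t] and [sqnD_le] doubles each, hence the factor 4. *)
have := sqnD_le (P *m (U *m b)) (P *m r).
rewrite -mulmxDr -hv -scalemxAr sqnZ => h.
have hPr := sqn_proj_le r Pt Pi.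
have h3 : t * sqn b <= t * e ^+ 2 by rewrite ler_wpM2l.
have e2 : 0 < e ^+ 2 by rewrite exprn_gt0.
rewrite -(ler_pM2l e2); move: h hPr h3 hPb hr'; nra.
Qed.
End Gram.

(** * The exchange argument *)

Section Selection.
Variable R : realFieldType.

Definition gram d (S : seq 'cV[R]_d) : 'M[R]_d := \sum_(u <- S) u *m u^T.

Lemma gram_factor d (S : seq 'cV[R]_d) :
  exists n (U : 'M_(d, n)), gram S = U *m U^T.
Proof.
elim: S => [|u S [n [U IH]]]; first by exists 0%N, 0; rewrite /gram big_nil mul0mx.
by exists (1 + n)%N, (row_mx u U); rewrite gram_row_mx /gram big_cons -IH.
Qed.

Lemma gram_map d (P : 'M[R]_d) S : gram [seq P *m u | u <- S] = P *m gram S *m P^T.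
Proof.
rewrite /gram big_map mulmx_sumr mulmx_suml; apply: eq_bigr => u _.
by rewrite trmx_mul !mulmxA.
Qed.

Lemma esp_gram_cons j d (u : 'cV[R]_d) S :
  esp j.+1 (gram (u :: S)) =
  esp j.+1 (gram S) + sqn u * esp j (gram [seq perp u *m s | s <- S]).
Proof.
rewrite /gram big_cons addrC esp_add_sqr; congr (_ + _ * _).
by rewrite -/(gram _) gram_map perp_tr [RHS]espC mulmxA perp_idem.
Qed.

Lemma gram_rem d (u : 'cV[R]_d) S : u \in S -> gram (rem u S) = gram S - u *m u^T.
Proof. by move=> uS; rewrite /gram [in RHS](big_rem u) //= addrAC subrr add0r. Qed.

(** By Cauchy-Binet, [esp j (gram S)] is a sum over the [j]-element sublists of [S], each of which
    survives [size S - j] of the removals. The induction on [S] stands in for that formula. *)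
Lemma sum_esp_rem j d (S : seq 'cV[R]_d) :
  \sum_(u <- S) esp j (gram S - u *m u^T) =
  ((size S)%:R - j%:R) * esp j (gram S).
Proof.
move: {2}(size S) (erefl (size S)) => n; elim: n S j => [|n IH] [|w S] j //= => [_|[sS]].
  rewrite big_nil /gram big_nil esp_mx0; case: j => [|j]; first by rewrite subrr mul0r.
  by rewrite mulr0.
have step (u : 'cV_d) : gram (w :: S) - u *m u^T = gram S - u *m u^T + w *m w^T.
  by rewrite /gram big_cons -addrA [LHS]addrC.
case: j => [|j].
  under eq_bigr do rewrite esp0.
  by rewrite esp0 mulr1 subr0 big_const_seq count_predT iter_addr_0 /= sS.
rewrite big_cons step subrK.
under eq_bigr => u _.
  rewrite step esp_add_sqr.
  (* Projecting off [w] turns this into a removal from the projected list, which the induction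
     hypothesis covers. *)
  have -> : esp j (perp w *m (gram S - u *m u^T)) =
            esp j (gram [seq perp w *m s | s <- S] - (perp w *m u) *m (perp w *m u)^T).
    rewrite gram_map trmx_mul perp_tr.
    have -> : perp w *m u *m (u^T *m perp w) = perp w *m (u *m u^T) *m perp w.
      by rewrite !mulmxA.
    rewrite -(mulmxBl _ _ (perp w)) -(mulmxBr (perp w)) [RHS]espC mulmxA.
    by rewrite perp_idem.
  over.
rewrite big_split /= -mulr_sumr IH //.
rewrite -(big_map (fun s => perp w *m s) xpredT
  (fun u => esp j (gram [seq perp w *m s | s <- S] - u *m u^T))).
rewrite IH ?size_map // esp_gram_cons.
rewrite -!natr1 /=; ring.
Qed.

(** [sum_esp_rem] for [v :: S], with the term that removes [v] itself taken out. *)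
Lemma sum_esp_exchange j d (S : seq 'cV[R]_d) v :
  \sum_(u <- S) esp j.+1 (gram S - u *m u^T + v *m v^T) =
  ((size S)%:R - j.+1%:R) * esp j.+1 (gram S)
  + ((size S)%:R - j%:R) * qf (grad j.+1 (gram S)) v.
Proof.
have := sum_esp_rem j.+1 (v :: S).
have step (u : 'cV_d) : gram (v :: S) - u *m u^T = gram S - u *m u^T + v *m v^T.
  by rewrite /gram big_cons -addrA [LHS]addrC.
rewrite big_cons step subrK; under eq_bigr do rewrite step.
have -> : gram (v :: S) = gram S + v *m v^T by rewrite /gram big_cons addrC.
rewrite esp_add_sqr -qf_grad /=.
by rewrite -!natr1 => h; lra.
Qed.

(* The degree [j] is the minimum of [k] and the rank of [V] when [size S >= k]. *)
Definition dominant d k (V S : seq 'cV[R]_d) :=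
  exists j, [/\ (j <= k)%N, 0 < esp j (gram S),
    forall S', size S' = size S -> {subset S' <= V} ->
      esp j (gram S') <= esp j (gram S)
  & (j < k)%N -> forall S', size S' = size S -> {subset S' <= V} ->
      esp j.+1 (gram S') <= 0].

Lemma exchange_mem d (V S : seq 'cV[R]_d) u v :
  {subset S <= V} -> v \in V -> u \in S ->
  [/\ size (v :: rem u S) = size S, {subset v :: rem u S <= V}
    & gram S - u *m u^T + v *m v^T = gram (v :: rem u S)].
Proof.
move=> SV vV uS; split.
- by rewrite /= size_rem // prednK // -has_predT; apply/hasP; exists u.
- by move=> s; rewrite inE => /orP[/eqP->//|/mem_rem/SV].
- by rewrite {2}/gram big_cons -/(gram _) gram_rem // addrC.
Qed.

Lemma sqn_proj_le_gram d k (V S : seq 'cV[R]_d) (P : 'M[R]_d) v :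
  (0 < k <= d)%N -> size S = k.*2 -> {subset S <= V} -> dominant k V S ->
  P^T = P -> P *m P = P -> \rank P = (d - k + 1)%N -> v \in V ->
  sqn (P *m v) <= 4 * \tr (gram S *m P).
Proof.
move=> /andP[k0 kd] sS SV [j [jk e0 jmax jnext]] Pt Pi Pr vV.
have [n [U UE]] := gram_factor S.
(* The complement of the range of [P] has dimension k - 1, which settles the rank alternative when j
   = k. *)
have hrank : (\rank (1%:M - P)%R < k)%N.
  have := mulmx0_rank_max (B := P) (A := 1%:M - P).
  by rewrite mulmxBl mul1mx Pi subrr => /(_ erefl); rewrite Pr; lia.
have -> : \tr (gram S *m P) = \tr (U^T *m P *m U).
  by rewrite UE -mulmxA mxtrace_mulC.
have sum_le i c : (forall S', size S' = size S -> {subset S' <= V} ->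
    esp i.+1 (gram S') <= c) ->
  \sum_(u <- S) esp i.+1 (gram S - u *m u^T + v *m v^T) <= (size S)%:R * c.
  move=> H.
  have -> : (size S)%:R * c = \sum_(u <- S) c.
    by rewrite big_const_seq count_predT iter_addr_0 mulr_natl.
  rewrite big_seq [leRHS]big_seq.
  apply: ler_sum => u uS.
  by have [h1 h2 ->] := exchange_mem SV vV uS; exact: H.
apply: (@proj_le_trace _ _ _ U j) => //; rewrite -UE //.
- case: (j) jk e0 jmax => [|i] ik e0 imax.
    by rewrite /qf /= mulmx0 mul0mx mxE ltW.
  (* With g the form at [v] and e the maximum, the averaged optimality reads (2k - i) g <= (i + 1)
     e, and i + 1 <= k gives g <= e. This is where the length 2k enters. *)
  have := sum_le _ _ imax; rewrite sum_esp_exchange sS.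
  have -> : k.*2%:R = k%:R + k%:R :> R by rewrite -natrD addnn.
  have : i.+1%:R <= k%:R :> R by rewrite ler_nat.
  rewrite -natr1; have : 0 <= i%:R :> R by rewrite ler0n.
  have : 0 <= qf (grad i.+1 (gram S)) v by rewrite UE grad_gram_ge0.
  by nra.
- have [jk'|] := ltnP j k; last by move=> kj; left; exact: leq_trans hrank kj.
  (* Degree j + 1 vanishes on all lists, so the averaged exchange forces the next form to be at most
     0 at [v]. *)
  right; have := sum_le _ _ (jnext jk'); rewrite sum_esp_exchange sS mulr0.
  have h1 : 0 <= esp j.+1 (gram S) by rewrite UE esp_gram_ge0.
  have h2 : 0 <= k.*2%:R - j.+1%:R :> R by rewrite subr_ge0 ler_nat -addnn; lia.
  have h3 : 0 < k.*2%:R - j%:R :> R by rewrite subr_gt0 ltr_nat -addnn; lia.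
  move=> h; rewrite -(pmulr_rle0 _ h3); apply: le_trans h.
  by rewrite lerDr mulr_ge0.
Qed.
End Selection.

(** * From a dominant list to a spanner *)

Section Spanner.
Variable R : realType.

Lemma sum_count_fset (V : zmodType) d (S : seq 'cV[R]_d) (F : 'cV[R]_d -> V) :
  \sum_(u <- [fset u in S]%fset) F u *+ count_mem u S = \sum_(u <- S) F u.
Proof.
have hp : perm_eq [fset u in S]%fset (undup S).
  by apply: uniq_perm; rewrite ?fset_uniq ?undup_uniq // => x; rewrite mem_undup inE.
rewrite (perm_big _ hp) -[RHS](@big_undup_iterop_count _ 0 +%R); apply: eq_bigr => u _.
by rewrite Monoid.iteropE /= iter_addr_0.
Qed.

Lemma trace_rank1 d (P : 'M[R]_d) v : P^T = P -> P *m P = P ->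
  \tr (v *m v^T *m P) = sqn (P *m v).
Proof.
move=> Pt Pi; rewrite -mulmxA mxtrace_mulC /sqn trmx_mul Pt mulmxA.
by rewrite -[v^T *m P *m P]mulmxA Pi /mxtrace big_ord1.
Qed.

Lemma spectral_spanner_dominant d k (V S : seq 'cV[R]_d) alpha :
  (0 < k <= d)%N -> size S = k.*2 -> {subset S <= V} -> dominant k V S ->
  8 * k%:R <= alpha ->
  spectral_spanner alpha k [fset v in V]%fset [fset u in S]%fset.
Proof.
move=> kd sS SV dom ha; split.
  by apply/fsubsetP => u; rewrite !inE => /SV.
move=> v; rewrite inE => vV.
have k0 : 0 < k%:R :> R by rewrite ltr0n; case/andP: kd.
have n0 : 0 < k.*2%:R :> R by rewrite ltr0n double_gt0 -(ltr0n R).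
(* [S] may repeat vectors, so the uniform weight of a position is multiplied by the multiplicity. *)
pose mu (u : 'cV[R]_d) : R := k.*2%:R^-1 * (count_mem u S)%:R.
exists mu.
  split=> [u _|]; first by rewrite mulr_ge0 ?invr_ge0 ?ler0n.
  rewrite /mu -mulr_sumr.
  rewrite (@sum_count_fset R d S (fun=> 1)) big_const_seq count_predT.
  by rewrite iter_addr_0 sS mulVf ?gt_eqF.
have -> : second_moment [fset u in S]%fset mu = k.*2%:R^-1 *: gram S.
  rewrite /second_moment /gram -(sum_count_fset S (fun u => u *m u^T)) scaler_sumr.
  by apply: eq_bigr => u _; rewrite -scaler_nat scalerA.
move=> P [Pt Pi] Pr; rewrite /mxdot Pt trace_rank1 //.
apply: le_trans (sqn_proj_le_gram kd sS SV dom Pt Pi Pr vV) _.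
rewrite scalerA -scalemxAl mxtraceZ; apply: ler_wpM2r.
  rewrite /gram mulmx_suml raddf_sum; apply: sumr_ge0 => u _.
  by rewrite /= trace_rank1 // sqn_ge0.
(* The factor 4 times the 2k that turns the average back into [gram S] is 8k. *)
rewrite ler_pdivlMr // -muln2 natrM; lra.
Qed.
End Spanner.

(** * Closure properties of the programs *)

Section Computable.
Variable R : realType.
Local Notation dat := (Defs.data R).

(* With the program existentially quantified, closure lemmas compose programs
   without naming them; [E] below is the type of environments. *)
Definition computable A B (eA : A -> dat) (eB : B -> dat) (f : A -> B) :=
  exists p, forall a, run p (eA a) (eB (f a)).

(** Any tree but [Nil] is true, so a nonempty list or a nonzero unary number can serve as its own
    test value. *)
Definition testable A (eA : A -> dat) (b : A -> bool) :=
  exists p, forall a, exists2 y, run p (eA a) y & truthy y = b a.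

Definition enc_pair A B (eA : A -> dat) (eB : B -> dat) (x : A * B) : dat :=
  Node (eA x.1) (eB x.2).

Definition enc_list A (eA : A -> dat) (s : seq A) : dat := enc_seq (map eA s).

Definition enc_nat_num (n : nat) : dat := Defs.Num n%:R.

(** Unary, as a list of [Nil]: successor, predecessor and zero test become tree operations, and a
    number can drive a loop over a list. *)
Definition enc_nat (n : nat) : dat := iter n (Node Defs.Nil) Defs.Nil.

Section Closure.
Variables (E A B C : Type).
Variables (eE : E -> dat) (eA : A -> dat) (eB : B -> dat) (eC : C -> dat).

Lemma computable_ext (f g : E -> A) :
  f =1 g -> computable eE eA f -> computable eE eA g.
Proof. by move=> fg [p hp]; exists p => e; rewrite -fg. Qed.

Lemma computable_id : computable eE eE (fun e => e).
Proof. by exists (Prim PId) => e; exact: run_prim. Qed.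

Lemma computable_comp (f : E -> A) (g : A -> B) :
  computable eE eA f -> computable eA eB g -> computable eE eB (fun e => g (f e)).
Proof. by move=> [p hp] [q hq]; exists (Seq p q) => e; apply: run_seq (hp e) (hq _). Qed.

Lemma computable_pair (f : E -> A) (g : E -> B) :
  computable eE eA f -> computable eE eB g ->
  computable eE (enc_pair eA eB) (fun e => (f e, g e)).
Proof. by move=> [p hp] [q hq]; exists (Pair p q) => e; apply: run_pair. Qed.

Lemma computable_comp2 (F : A -> B -> C) (f : E -> A) (g : E -> B) :
  computable (enc_pair eA eB) eC (fun x => F x.1 x.2) ->
  computable eE eA f -> computable eE eB g ->
  computable eE eC (fun e => F (f e) (g e)).
Proof.
move=> [r hr] [p hp] [q hq]; exists (Seq (Pair p q) r) => e.
by apply: run_seq (run_pair (hp e) (hq e)) (hr (f e, g e)).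
Qed.

Lemma computable_fst (f : E -> A * B) :
  computable eE (enc_pair eA eB) f -> computable eE eA (fun e => (f e).1).
Proof.
move=> [p hp]; exists (Seq p (Prim PFst)) => e; apply: run_seq (hp e) _.
exact: run_prim.
Qed.

Lemma computable_snd (f : E -> A * B) :
  computable eE (enc_pair eA eB) f -> computable eE eB (fun e => (f e).2).
Proof.
move=> [p hp]; exists (Seq p (Prim PSnd)) => e; apply: run_seq (hp e) _.
exact: run_prim.
Qed.

Lemma computable_arith (o : Defs.prim) (op : R -> R -> R) (f g : E -> R) :
  (forall a b, prim_sem o (Node (Defs.Num a) (Defs.Num b)) = Defs.Num (op a b)) ->
  computable eE (@Defs.Num R) f -> computable eE (@Defs.Num R) g ->
  computable eE (@Defs.Num R) (fun e => op (f e) (g e)).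
Proof.
move=> ho [p hp] [q hq]; exists (Seq (Pair p q) (Prim o)) => e.
by apply: run_seq (run_pair (hp e) (hq e)) _; rewrite -ho; exact: run_prim.
Qed.

Lemma computable_add (f g : E -> R) :
  computable eE (@Defs.Num R) f -> computable eE (@Defs.Num R) g ->
  computable eE (@Defs.Num R) (fun e => f e + g e).
Proof. exact: (@computable_arith PAdd +%R). Qed.

Lemma computable_sub (f g : E -> R) :
  computable eE (@Defs.Num R) f -> computable eE (@Defs.Num R) g ->
  computable eE (@Defs.Num R) (fun e => f e - g e).
Proof. exact: (@computable_arith PSub (fun a b => a - b)). Qed.

Lemma computable_mul (f g : E -> R) :
  computable eE (@Defs.Num R) f -> computable eE (@Defs.Num R) g ->
  computable eE (@Defs.Num R) (fun e => f e * g e).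
Proof. exact: (@computable_arith PMul *%R). Qed.

Lemma computable_div (f g : E -> R) :
  computable eE (@Defs.Num R) f -> computable eE (@Defs.Num R) g ->
  computable eE (@Defs.Num R) (fun e => f e / g e).
Proof. exact: (@computable_arith PDiv (fun a b => a / b)). Qed.

Lemma computable_0 : computable eE (@Defs.Num R) (fun=> 0).
Proof. by exists (Prim PZero) => e; exact: (run_prim PZero). Qed.

Lemma computable_1 : computable eE (@Defs.Num R) (fun=> 1).
Proof. by exists (Prim POne) => e; exact: (run_prim POne). Qed.

Lemma computable_nil : computable eE (enc_list eA) (fun=> [::]).
Proof. by exists (Prim PNil) => e; exact: (run_prim PNil). Qed.

Lemma computable_cons (f : E -> A) (g : E -> seq A) :
  computable eE eA f -> computable eE (enc_list eA) g ->
  computable eE (enc_list eA) (fun e => f e :: g e).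
Proof. by move=> [p hp] [q hq]; exists (Pair p q) => e; apply: run_pair. Qed.

Lemma computable_behead (f : E -> seq A) :
  computable eE (enc_list eA) f -> computable eE (enc_list eA) (fun e => behead (f e)).
Proof.
move=> [p hp]; exists (Seq p (Prim PSnd)) => e; apply: run_seq (hp e) _.
by case: (f e) => [|a s]; exact: (run_prim PSnd).
Qed.

Lemma computable_head x0 (f : E -> seq A) : eA x0 = Defs.Nil ->
  computable eE (enc_list eA) f -> computable eE eA (fun e => head x0 (f e)).
Proof.
move=> h0 [p hp]; exists (Seq p (Prim PFst)) => e; apply: run_seq (hp e) _.
case: (f e) => [|a s] /=; last exact: (run_prim PFst).
by rewrite h0; exact: (run_prim PFst).
Qed.

(* Arithmetic reads a non-number as 0, so adding 0 to the first component of
   [Nil] yields the default. *)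
Lemma computable_head0 (f : E -> seq R) :
  computable eE (enc_list (@Defs.Num R)) f -> computable eE (@Defs.Num R) (fun e => head 0 (f e)).
Proof.
move=> [p hp].
exists (Seq p (Seq (Pair (Prim PZero) (Prim PFst)) (Prim PAdd))) => e.
apply: run_seq (hp e) _; apply: run_seq.
  by apply: run_pair; exact: run_prim.
suff -> : Defs.Num (head 0 (f e)) =
    prim_sem PAdd (Node (Defs.Num 0) (fstd (enc_list (@Defs.Num R) (f e)))) by exact: run_prim.
by case: (f e) => [|a s]; rewrite /= add0r.
Qed.

Lemma computable_0nat : computable eE enc_nat (fun=> 0%N).
Proof. by exists (Prim PNil) => e; exact: (run_prim PNil). Qed.

Lemma computable_succ (f : E -> nat) :
  computable eE enc_nat f -> computable eE enc_nat (fun e => (f e).+1).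
Proof.
move=> [p hp]; exists (Pair (Prim PNil) p) => e.
by apply: run_pair (hp e); exact: run_prim.
Qed.

Lemma computable_pred (f : E -> nat) :
  computable eE enc_nat f -> computable eE enc_nat (fun e => (f e).-1).
Proof.
move=> [p hp]; exists (Seq p (Prim PSnd)) => e; apply: run_seq (hp e) _.
by case: (f e) => [|n]; exact: (run_prim PSnd).
Qed.

Lemma computable_if (b : E -> bool) (f g : E -> A) :
  testable eE b -> computable eE eA f -> computable eE eA g ->
  computable eE eA (fun e => if b e then f e else g e).
Proof.
move=> [t ht] [p hp] [q hq]; exists (If t p q) => e.
have [y hy yb] := ht e; case: ifP => be.
  by apply: run_if_true hy _ (hp e); rewrite yb.
by apply: run_if_false hy _ (hq e); rewrite yb be.
Qed.

Lemma testable_le (f g : E -> R) :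
  computable eE (@Defs.Num R) f -> computable eE (@Defs.Num R) g ->
  testable eE (fun e => f e <= g e).
Proof.
move=> [p hp] [q hq]; exists (Seq (Pair p q) (Prim PLe)) => e.
eexists; first by apply: run_seq (run_pair (hp e) (hq e)) (run_prim PLe _).
by rewrite /=; case: (_ <= _).
Qed.

Lemma testable_nilp (f : E -> seq A) :
  computable eE (enc_list eA) f -> testable eE (fun e => ~~ nilp (f e)).
Proof. by move=> [p hp]; exists p => e; exists (enc_list eA (f e)); last case: (f e). Qed.

Lemma testable_neq0 (f : E -> nat) :
  computable eE enc_nat f -> testable eE (fun e => f e != 0%N).
Proof. by move=> [p hp]; exists p => e; exists (enc_nat (f e)); last case: (f e). Qed.

(** The loop stores the accumulator, the unread list and the environment; the unread list is the
    loop test. *)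
Lemma computable_foldl (g : A -> B -> E -> A) (a0 : E -> A) (l : E -> seq B) :
  computable (enc_pair eA (enc_pair eB eE)) eA (fun x => g x.1 x.2.1 x.2.2) ->
  computable eE eA a0 -> computable eE (enc_list eB) l ->
  computable eE eA (fun e => foldl (fun a b => g a b e) (a0 e) (l e)).
Proof.
move=> [pg hg] [pa ha] [pl hl].
(* [arg] turns the store (a, (b :: s, e)) into the argument (a, (b, e)) of [g]. *)
pose arg := Pair (Prim PFst) (Pair (Seq (Prim PSnd) (Seq (Prim PFst) (Prim PFst)))
                                  (Seq (Prim PSnd) (Prim PSnd))).
pose body := Pair (Seq arg pg) (Pair (Seq (Prim PSnd) (Seq (Prim PFst) (Prim PSnd)))
                                     (Seq (Prim PSnd) (Prim PSnd))).
pose loop := While (Seq (Prim PSnd) (Prim PFst)) body.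
have pP o (x : dat) : run (Prim o) x (prim_sem o x) by exact: run_prim.
have path2 o o' (x : dat) : run (Seq (Prim o) (Prim o')) x (prim_sem o' (prim_sem o x)).
  by apply: run_seq; exact: run_prim.
have path3 o1 o2 o3 (x : dat) : run (Seq (Prim o1) (Seq (Prim o2) (Prim o3))) x
    (prim_sem o3 (prim_sem o2 (prim_sem o1 x))).
  by apply: run_seq; [exact: run_prim | exact: path2].
have loopP e s a : run loop (Node (eA a) (Node (enc_list eB s) (eE e)))
    (Node (eA (foldl (fun a b => g a b e) a s)) (Node Defs.Nil (eE e))).
  elim: s a => [|b s IH] a /=.
    exact: run_while_false _ (path2 PSnd PFst _) _.
  apply: run_while_true (path2 PSnd PFst _) _ _ (IH (g a b e)) => //.
  apply: run_pair; last by apply: run_pair; [exact: path3 | exact: path2].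
  apply: (run_seq _ (hg (a, (b, e)))).
  apply: run_pair; first exact: pP.
  by apply: run_pair; [exact: path3 | exact: path2].
exists (Seq (Pair pa (Pair pl (Prim PId))) (Seq loop (Prim PFst))) => e.
apply: run_seq; first by apply: run_pair (ha e) (run_pair (hl e) (pP PId _)).
by apply: run_seq (loopP _ _ _) (pP PFst _).
Qed.

(** The number is counted down by 1 while it is at least 1, pushing one [Nil] per round. *)
Lemma computable_nat_of_num (f : E -> nat) :
  computable eE enc_nat_num f -> computable eE enc_nat f.
Proof.
move=> [p hp].
pose loop := While (Seq (Pair (Prim POne) (Prim PFst)) (Prim PLe))
  (Pair (Seq (Pair (Prim PFst) (Prim POne)) (Prim PSub)) (Pair (Prim PNil) (Prim PSnd))).
have pP o (x : dat) : run (Prim o) x (prim_sem o x) by exact: run_prim.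
have loopP n m : run loop (Node (Defs.Num n%:R) (enc_nat m)) (Node (Defs.Num 0) (enc_nat (n + m))).
  have testP i j : run (Seq (Pair (Prim POne) (Prim PFst)) (Prim PLe))
      (Node (Defs.Num i%:R) (enc_nat j)) (Defs.of_bool R ((1 : R) <= i%:R)).
    apply: run_seq; first by apply: run_pair; exact: run_prim.
    exact: (run_prim PLe).
  elim: n m => [|n IH] m.
    by apply: (run_while_false _ (testP _ _)); rewrite ler10.
  apply: run_while_true (testP _ _) _ _ _.
  - by rewrite ler1n.
  - apply: run_pair; last by apply: run_pair; exact: pP.
    apply: run_seq; first by apply: run_pair; exact: run_prim.
    exact: run_prim.
  - by move: (IH m.+1); rewrite addnS /= -[n.+1%:R]natr1 addrK.
exists (Seq (Pair p (Prim PNil)) (Seq loop (Prim PSnd))) => e.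
apply: run_seq; first exact: run_pair (hp e) (pP PNil _).
apply: run_seq; first exact: (loopP (f e) 0%N).
by rewrite addn0; exact: (pP PSnd).
Qed.
End Closure.

Lemma computable_iter E A (eE : E -> dat) (eA : A -> dat)
    (g : A -> E -> A) (a0 : E -> A) (n : E -> nat) :
  computable (enc_pair eA eE) eA (fun x => g x.1 x.2) ->
  computable eE eA a0 -> computable eE enc_nat n ->
  computable eE eA (fun e => iter (n e) (fun a => g a e) (a0 e)).
Proof.
move=> hg ha [p hn].
(* The unary encoding of [n] is also that of a list of [n] units, over which a fold is an
   iteration. *)
pose eT (_ : unit) : dat := Defs.Nil.
apply: (@computable_ext _ _ _ _
  (fun e => foldl (fun a (_ : unit) => g a e) (a0 e) (nseq (n e) tt))).
  by move=> e; elim: (n e) (a0 e) => //= m IH a; rewrite IH -iterSr.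
apply: (@computable_foldl _ _ _ eE eA eT (fun a _ e => g a e)) => //.
  apply: (@computable_comp2 _ _ _ _ _ eA eE) => //.
    exact/computable_fst/computable_id.
  exact/computable_snd/computable_snd/computable_id.
exists p => e; move: (hn e).
by rewrite /enc_list map_nseq /enc_nat; congr run; elim: (n e) => //= m ->.
Qed.

End Computable.

(* Access to a variable of the environment, a nest of projections. *)
Ltac var := repeat first
  [exact: computable_id | eapply computable_fst | eapply computable_snd].

Section Lists.
Variables (R : realType) (E A B : Type).
Variables (eE : E -> data R) (eA : A -> data R) (eB : B -> data R).

Lemma computable_rev (l : E -> seq A) :
  computable eE (enc_list eA) l -> computable eE (enc_list eA) (fun e => rev (l e)).
Proof.
move=> hl; apply: (@computable_ext _ _ _ _ _
  (fun e => foldl (fun s a => a :: s) [::] (l e))).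
  by move=> e; rewrite -[RHS]cats0; elim: (l e) [::] => //= a s IH t; rewrite IH rev_cons cat_rcons.
apply: (computable_foldl (eB := eA) (g := fun s a _ => a :: s)) hl.
  by apply: computable_cons; var.
exact: computable_nil.
Qed.

Lemma computable_map (f : B -> E -> A) (l : E -> seq B) :
  computable (enc_pair eB eE) eA (fun x => f x.1 x.2) ->
  computable eE (enc_list eB) l ->
  computable eE (enc_list eA) (fun e => [seq f b e | b <- l e]).
Proof.
move=> hf hl; apply: (@computable_ext _ _ _ _ _
  (fun e => rev (foldl (fun s b => f b e :: s) [::] (l e)))).
  move=> e; rewrite -[RHS]revK -[rev (map _ _)]cats0; congr rev.
  by elim: (l e) [::] => //= b s IH t; rewrite IH rev_cons cat_rcons.
apply: computable_rev.
apply: (computable_foldl (eB := eB) (g := fun s b e => f b e :: s)) hl.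
  apply: computable_cons; last by var.
  by apply: (computable_comp2 (eA := eB) (eB := eE) hf); var.
exact: computable_nil.
Qed.

End Lists.

(** * The search *)

Section Algorithm.
Variable R : realFieldType.

(* [esp_tasks nrm proj j S] unfolds the recursion of [esp_gram_cons] breadth first: a
   task [(c, (i, S'))] stands for the summand [c * esp i (gram S')]. *)
Section Tasks.
Variables (T : Type) (nrm : T -> R) (proj : T -> T -> T).

Definition split_task (t : R * (nat * seq T)) :=
  if t.2.2 is u :: W then
    (t.1, (t.2.1, W)) ::
    (if t.2.1 is i.+1 then [:: (t.1 * nrm u, (i, [seq proj u s | s <- W]))]
     else [::])
  else [:: t].

Definition esp_tasks j (S : seq T) : R :=
  foldl (fun a t => if t.2.1 != 0%N then a else a + t.1) 0
    (iter (size S) (fun ts => flatten [seq split_task t | t <- ts]) [:: (1, (j, S))]).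

Definition tuples (V : seq T) n : seq (seq T) :=
  iter n (fun L => flatten [seq [seq v :: W | v <- V] | W <- L]) [:: [::]].

(** Ties keep [best], so a degree that vanishes on all lists leaves the current list unchanged. *)
Definition improve (L : seq (seq T)) j S :=
  foldl (fun best S' => if esp_tasks j S' <= esp_tasks j best then best else S') S L.

(** The degrees 0, ..., k are maximised in turn; the list that remains is optimal for the last
    degree with a positive value, so the rank of [V] is never computed. *)
Definition select k (V : seq T) : seq T :=
  let L := tuples V (k + k) in
  (iter k.+1 (fun st => (st.1.+1, improve L st.1 st.2)) (0%N, head [::] L)).2.

Lemma select_nil k : (0 < k)%N -> select k [::] = [::].
Proof.
case: k => // k _; rewrite /select.
have -> : tuples [::] (k.+1 + k.+1) = [::].
  by rewrite addSn /=; elim: (tuples _ _).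
rewrite [head _ _]/=; suff h n : (iter n (fun st => (st.1.+1, improve [::] st.1 st.2))
    (0%N, [::] : seq T)).2 = [::] by exact: h.
by elim: n => //= n ->.
Qed.

End Tasks.

(** * Transport of the search along an encoding of vectors *)

Section Naturality.
Variables (T T' : Type) (h : T -> T') (nrm : T -> R) (nrm' : T' -> R).
Variables (proj : T -> T -> T) (proj' : T' -> T' -> T').
Hypothesis hnrm : forall u, nrm' (h u) = nrm u.
Hypothesis hproj : forall u s, proj' (h u) (h s) = h (proj u s).

Let ht (t : R * (nat * seq T)) := (t.1, (t.2.1, map h t.2.2)).

Lemma split_task_map t : split_task nrm' proj' (ht t) = map ht (split_task nrm proj t).
Proof.
case: t => c [[|j] [|u S]] //=; rewrite /ht /= /split_task /= hnrm -!map_comp.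
by congr [:: _; (_, (_, _))]; apply: eq_map => s; rewrite /= hproj.
Qed.

Lemma esp_tasks_map j S : esp_tasks nrm' proj' j (map h S) = esp_tasks nrm proj j S.
Proof.
rewrite /esp_tasks size_map.
have -> : [:: (1, (j, map h S))] = map ht [:: (1, (j, S))] by [].
have -> n ts : iter n (fun ts => flatten [seq split_task nrm' proj' t | t <- ts])
    (map ht ts) =
  map ht (iter n (fun ts => flatten [seq split_task nrm proj t | t <- ts]) ts).
  elim: n => //= n ->; rewrite -map_comp map_flatten -map_comp.
  by congr flatten; apply: eq_map => t; rewrite /= split_task_map.
by move: (iter _ _ _) 0 => ts; elim: ts => //= t ts IH a; rewrite IH.
Qed.

Lemma tuples_map V n : tuples (map h V) n = map (map h) (tuples V n).
Proof.
elim: n => //= n ->; rewrite -map_comp map_flatten -map_comp.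
by congr flatten; apply: eq_map => S; rewrite /= -!map_comp; apply: eq_map.
Qed.

(** The search touches vectors only through [nrm] and [proj]; this carries its correctness on column
    vectors over to coordinate lists. *)
Lemma select_map k V : select nrm' proj' k (map h V) = map h (select nrm proj k V).
Proof.
rewrite /select tuples_map; set L := tuples _ _.
have himp j S : improve nrm' proj' (map (map h) L) j (map h S) =
                map h (improve nrm proj L j S).
  rewrite /improve; elim: L S => //= S' L IH S.
  by rewrite !esp_tasks_map; case: ifP => _; rewrite IH.
have -> : head [::] (map (map h) L) = map h (head [::] L) by case: (L).
move: (head _ _) => S0.
suff -> : iter k.+1 (fun st => (st.1.+1, improve nrm' proj' (map (map h) L) st.1 st.2))
    (0%N, map h S0) =
  (fun st => (st.1, map h st.2))
   (iter k.+1 (fun st => (st.1.+1, improve nrm proj L st.1 st.2)) (0%N, S0)) by [].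
by elim: k.+1 => //= n ->; rewrite /= himp.
Qed.
End Naturality.

Lemma tuplesP (T : eqType) (V : seq T) n S :
  (S \in tuples V n) = (size S == n) && all (mem V) S.
Proof.
elim: n S => [|n IH] S /=; first by rewrite inE; case: S.
apply/flatten_mapP/idP => [[S' hS' /mapP[v vV ->]]|].
  by move: hS'; rewrite IH /= eqSS vV => /andP[-> ->].
case: S => //= v S; rewrite eqSS => /and3P[sS vV hS].
by exists S; [rewrite IH sS | apply: map_f].
Qed.

(** * Correctness of the search *)

Section SelectSpec.
Variable d : nat.
Local Notation nrm := (@sqn R d).
Local Notation proj := (fun u s : 'cV[R]_d => perp u *m s).

(** A round preserves [val] by [esp_gram_cons] and shortens every list by one. After [size S] rounds
    all lists are empty, and there [esp] is 1 in degree 0 and 0 otherwise. *)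
Lemma esp_tasksE j (S : seq 'cV[R]_d) : esp_tasks nrm proj j S = esp j (gram S).
Proof.
pose val (ts : seq (R * (nat * seq 'cV[R]_d))) :=
  \sum_(t <- ts) t.1 * esp t.2.1 (gram t.2.2).
pose step (ts : seq (R * (nat * seq 'cV[R]_d))) :=
  flatten [seq split_task nrm proj t | t <- ts].
have val_step ts : val (step ts) = val ts.
  rewrite /val /step big_flatten big_map; apply: eq_bigr => [] [c [j' [|u S']]] _ /=.
    by rewrite big_seq1.
  rewrite big_cons /=; case: j' => [|i]; first by rewrite !esp0 big_nil addr0.
  by rewrite big_seq1 /= esp_gram_cons mulrDr mulrA.
have size_step n ts : all (fun t => size t.2.2 == n.+1) ts ->
    all (fun t => size t.2.2 == n) (step ts).
  move=> hts; apply/allP => t' /flatten_mapP[t tts]; have := allP hts t tts.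
  case: t {tts} => c [[|i] [|u S']] //=; rewrite eqSS /split_task /= !inE => /eqP hs.
    by move=> /eqP->; rewrite /= hs.
  by move=> /orP[]/eqP->; rewrite /= ?size_map hs.
have main n ts : all (fun t => size t.2.2 == n) ts ->
    val (iter n step ts) = val ts /\ all (fun t => size t.2.2 == 0%N) (iter n step ts).
  elim: n ts => [|n IH] ts hts //; rewrite iterSr.
  by have [-> ->] := IH _ (size_step _ _ hts); rewrite val_step.
have leaf a ts : all (fun t : R * (nat * seq 'cV[R]_d) => size t.2.2 == 0%N) ts ->
    foldl (fun a t => if t.2.1 != 0%N then a else a + t.1) a ts = a + val ts.
  elim: ts a => [|[c [i S']] ts IH] a /=; first by rewrite /val big_nil addr0.
  case/andP=> /nilP -> /IH ->; rewrite /val big_cons /= /gram big_nil esp_mx0.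
  by case: i => [|i] /=; rewrite ?mulr1 ?mulr0 ?add0r ?addrA.
have [h1 h2] : val (iter (size S) step [:: (1, (j, S))]) = val [:: (1, (j, S))] /\
   all (fun t => size t.2.2 == 0%N) (iter (size S) step [:: (1, (j, S))]).
  by apply: main; rewrite /= eqxx.
by rewrite /esp_tasks leaf // h1 /val big_seq1 mul1r add0r.
Qed.

Lemma improveP (L : seq (seq 'cV[R]_d)) j S : S \in L ->
  [/\ improve nrm proj L j S \in L,
    forall S', S' \in L -> esp j (gram S') <= esp j (gram (improve nrm proj L j S))
  & (forall S', S' \in L -> esp j (gram S') <= esp j (gram S)) ->
    improve nrm proj L j S = S].
Proof.
move=> SL; rewrite /improve.
have foldP (M : seq (seq 'cV[R]_d)) B :
  let r := foldl (fun best S' =>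
      if esp_tasks nrm proj j S' <= esp_tasks nrm proj j best then best else S') B M in
  [/\ r \in B :: M, forall S', S' \in B :: M -> esp j (gram S') <= esp j (gram r)
   & (forall S', S' \in M -> esp j (gram S') <= esp j (gram B)) -> r = B].
  elim: M B => [|S' M IH] B /=.
    by split=> // [|S'']; rewrite inE // => /eqP->.
  rewrite !esp_tasksE; have [le|lt] := leP (esp j (gram S')) (esp j (gram B)).
    have [h1 h2 h3] := IH B; split.
    - by move: h1; rewrite !inE => /orP[->|->]; rewrite ?orbT.
    - move=> S''; rewrite !inE => /or3P[/eqP->|/eqP->|h]; last by apply: h2; rewrite inE h orbT.
        by apply: h2; rewrite inE eqxx.
      by apply: le_trans le _; apply: h2; rewrite inE eqxx.
    - by move=> h; apply: h3 => S'' hS; apply: h; rewrite inE hS orbT.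
  have [h1 h2 h3] := IH S'; split.
  - by rewrite inE h1 orbT.
  - move=> S''; rewrite inE => /orP[/eqP->|]; last exact: h2.
    by apply: le_trans (ltW lt) _; apply: h2; rewrite inE eqxx.
  - by move=> h; have := h S' (mem_head _ _); rewrite leNgt lt.
have [h1 h2 h3] := foldP L S; split=> //.
  by move: h1; rewrite inE => /orP[/eqP->|].
by move=> S' hS'; apply: h2; rewrite inE hS' orbT.
Qed.

Lemma select_dominant k (V : seq 'cV[R]_d) : V != [::] ->
  [/\ size (select nrm proj k V) = k.*2, {subset select nrm proj k V <= V}
    & dominant k V (select nrm proj k V)].
Proof.
move=> V0; rewrite /select; set L := tuples V (k + k).
have LP S : (S \in L) = (size S == k.*2) && all (mem V) S.
  by rewrite tuplesP addnn.
pose st n := iter n (fun st => (st.1.+1, improve nrm proj L st.1 st.2)) (0%N, head [::] L).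
have L0 : head [::] L \in L.
  have [v vV] : exists v, v \in V by case: (V) V0 => // v ? _; exists v; rewrite mem_head.
  have : nseq k.*2 v \in L by rewrite LP size_nseq eqxx all_nseq /= vV orbT.
  by case: (L) => // S ? _; rewrite mem_head.
have inv n : (st n).1 = n /\ (st n).2 \in L.
  elim: n => [|n [IH1 IH2]] //=; split; first by rewrite IH1.
  by have [] := improveP (st n).1 IH2.
(* After stages 0, ..., n, [j] is the last degree up to [n] that is positive on some list, and the
   current list maximises it. *)
have dom n : exists j, [/\ (j <= n)%N, 0 < esp j (gram (st n.+1).2),
    forall S', S' \in L -> esp j (gram S') <= esp j (gram (st n.+1).2)
  & (j < n)%N -> forall i, (j < i <= n)%N -> forall S', S' \in L ->
      esp i (gram S') <= 0].
  elim: n => [|n [j [jn j0 jmax jnext]]].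
    exists 0%N; split=> // [|S' _]; by rewrite !esp0.
  have [hn SL] := inv n.+1; have [h1 h2 h3] := improveP n.+1 SL.
  have stE : (st n.+2).2 = improve nrm proj L n.+1 (st n.+1).2 by rewrite /= -[in RHS]hn.
  rewrite stE.
  (* Either degree n + 1 is positive and takes over as [j], or it vanishes on all lists and
     [improve] keeps the current one. *)
  have [pos|npos] := ltP 0 (esp n.+1 (gram (improve nrm proj L n.+1 (st n.+1).2))).
    by exists n.+1; split=> //; rewrite ltnn.
  have z S' : S' \in L -> esp n.+1 (gram S') <= 0 by move=> /h2 h; exact: le_trans h npos.
  exists j; rewrite h3; last first.
    move=> S' /z h; apply: le_trans h _.
    by have [m [U ->]] := gram_factor (st n.+1).2; exact: esp_gram_ge0.
  split=> //; first exact: leqW.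
  move=> _ i /andP[ji]; rewrite leq_eqVlt => /orP[/eqP-> //|]; rewrite ltnS => hi.
  by apply: jnext; rewrite ?ji // (leq_trans ji hi).
have [_ SL] := inv k.+1; move: (SL); rewrite LP => /andP[/eqP sS SV].
split=> //; first exact/allP.
have [j [jk j0 jmax jnext]] := dom k.
exists j; split=> // [S' hs hV|jk' S' hs hV].
  by apply: jmax; rewrite LP hs sS eqxx; apply/allP.
by apply: (jnext jk' j.+1); rewrite ?ltnSn // LP hs sS eqxx; apply/allP.
Qed.
End SelectSpec.
End Algorithm.

(** * The search as a program *)

Section Program.
Variable R : realType.

(** The fold carries the unread part of the second list in its state, since [computable_foldl]
    traverses a single list. *)
Definition dot_seq (s t : seq R) : R :=
  (foldl (fun a x => (a.1 + x * head 0 a.2, behead a.2)) (0, t) s).1.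

Definition perp_seq (u s : seq R) : seq R :=
  rev (foldl (fun a x => (x - dot_seq s u / dot_seq u u * head 0 a.2 :: a.1, behead a.2))
    ([::], u) s).1.

Definition entries d (v : 'cV[R]_d) : seq R := [seq v i 0 | i <- enum 'I_d].

Lemma dot_entries d (u v : 'cV[R]_d) : dot_seq (entries u) (entries v) = (u^T *m v) 0 0.
Proof.
have -> : (u^T *m v) 0 0 = \sum_(i <- enum 'I_d) u i 0 * v i 0.
  by rewrite big_enum mxE; apply: eq_bigr => i _; rewrite mxE.
suff gen r a : (foldl (fun a x => (a.1 + x * head 0 a.2, behead a.2))
    (a, [seq v i 0 | i <- r]) [seq u i 0 | i <- r]).1 = a + \sum_(i <- r) u i 0 * v i 0.
  by rewrite /dot_seq gen add0r.
elim: r a => /= [|i r IH] a; first by rewrite big_nil addr0.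
by rewrite IH big_cons addrA.
Qed.

Lemma perp_entries d (u s : 'cV[R]_d) :
  perp_seq (entries u) (entries s) = entries (perp u *m s).
Proof.
have -> : perp u *m s = s - ((s^T *m u) 0 0 / sqn u) *: u.
  rewrite /perp mulmxBl mul1mx -scalemxAl -mulmxA [u^T *m s]mx11_scalar.
  rewrite mul_mx_scalar scalerA mulrC; congr (_ - (_ * _) *: _).
  by rewrite -[in LHS](trmxK s) -trmx_mul mxE.
rewrite /perp_seq !dot_entries -/(sqn u); set c := _ / _.
suff gen r a : rev (foldl (fun a x => (x - c * head 0 a.2 :: a.1, behead a.2))
    (a, [seq u i 0 | i <- r]) [seq s i 0 | i <- r]).1 =
    rev a ++ [seq (s - c *: u) i 0 | i <- r].
  by rewrite /entries gen.
elim: r a => /= [|i r IH] a; first by rewrite cats0.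
by rewrite IH rev_cons cat_rcons !mxE.
Qed.

Local Notation eR := (@Defs.Num R).
Local Notation eV := (enc_list (@Defs.Num R)).

Lemma computable_dot_seq E (eE : E -> data R) (f g : E -> seq R) :
  computable eE eV f -> computable eE eV g ->
  computable eE eR (fun e => dot_seq (f e) (g e)).
Proof.
move=> hf hg; apply: computable_fst.
apply: (computable_foldl (eA := enc_pair eR eV) (eB := eR)
  (g := fun a x _ => (a.1 + x * head 0 a.2, behead a.2))) hf.
  apply: computable_pair; last by apply: computable_behead; var.
  apply: computable_add; first by var.
  by apply: computable_mul; [var | apply: computable_head0; var].
by apply: computable_pair hg; exact: computable_0.
Qed.

Lemma computable_perp_seq E (eE : E -> data R) (f g : E -> seq R) :
  computable eE eV f -> computable eE eV g ->
  computable eE eV (fun e => perp_seq (f e) (g e)).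
Proof.
move=> hf hg; apply: computable_rev; apply: computable_fst.
apply: (computable_foldl (eA := enc_pair eV eV) (eB := eR)
  (g := fun a x e => (x - dot_seq (g e) (f e) / dot_seq (f e) (f e) * head 0 a.2 :: a.1,
                      behead a.2))) (hg).
  have hE (h : E -> seq R) : computable eE eV h ->
      computable (enc_pair (enc_pair eV eV) (enc_pair eR eE)) eV (fun x => h x.2.2).
    by move=> hh; apply: (computable_comp (eA := eE) (g := h) _ hh); var.
  apply: computable_pair; last by apply: computable_behead; var.
  apply: computable_cons; last by var.
  apply: computable_sub; first by var.
  apply: computable_mul; last by apply: computable_head0; var.
  by apply: computable_div; apply: computable_dot_seq; exact: hE.
by apply: computable_pair hf; exact: computable_nil.
Qed.

Lemma computable_cat E (eE : E -> data R) A (eA : A -> data R) (f g : E -> seq A) :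
  computable eE (enc_list eA) f -> computable eE (enc_list eA) g ->
  computable eE (enc_list eA) (fun e => f e ++ g e).
Proof.
move=> hf hg; apply: (@computable_ext _ _ _ _ _
  (fun e => foldl (fun s a => a :: s) (g e) (rev (f e)))).
  by move=> e; rewrite foldl_rev; elim: (f e) => //= a s ->.
apply: (computable_foldl (eB := eA) (g := fun s a _ => a :: s)) => //.
  by apply: computable_cons; var.
exact: computable_rev.
Qed.

Lemma computable_flatten E (eE : E -> data R) A (eA : A -> data R) (f : E -> seq (seq A)) :
  computable eE (enc_list (enc_list eA)) f ->
  computable eE (enc_list eA) (fun e => flatten (f e)).
Proof.
move=> hf; apply: (@computable_ext _ _ _ _ _
  (fun e => foldl (fun s t => s ++ t) [::] (f e))).
  move=> e; rewrite -[RHS]cat0s.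
  by elim: (f e) [::] => [|s ss IH] t /=; rewrite ?cats0 // IH catA.
apply: (computable_foldl (eB := enc_list eA) (g := fun s t _ => s ++ t)) hf.
  by apply: computable_cat; var.
exact: computable_nil.
Qed.

Local Notation eT := (enc_pair eR (enc_pair (@enc_nat R) (enc_list eV))).
Local Notation nrm := (fun u => dot_seq u u).

Lemma computable_split_task : computable eT (enc_list eT) (split_task nrm perp_seq).
Proof.
pose hd (t : R * (nat * seq (seq R))) := head [::] t.2.2.
apply: (@computable_ext _ _ _ _ _
  (fun t => if ~~ nilp t.2.2 then (t.1, (t.2.1, behead t.2.2)) ::
     (if t.2.1 != 0%N then
        [:: (t.1 * dot_seq (hd t) (hd t),
             (t.2.1.-1, [seq perp_seq (hd t) s | s <- behead t.2.2]))]
      else [::]) else [:: t])).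
  by move=> [c [[|j] [|u S]]].
have hhd : computable eT eV hd by apply: computable_head => //; var.
apply: computable_if; first by apply: (testable_nilp (eA := eV)); var.
  apply: computable_cons.
    by apply: computable_pair; [var | apply: computable_pair; [var |
      apply: computable_behead; var]].
  apply: computable_if; [by apply: testable_neq0; var | | exact: computable_nil].
  apply: computable_cons; last exact: computable_nil.
  apply: computable_pair.
    by apply: computable_mul; [var | exact: computable_dot_seq].
  apply: computable_pair; first by apply: computable_pred; var.
  apply: (computable_map (eB := eV) (f := fun s t => perp_seq (hd t) s)).
    apply: computable_perp_seq; last by var.
    by apply: (computable_comp (eA := eT) (g := hd) _ hhd); var.
  by apply: computable_behead; var.
by apply: computable_cons; [var | exact: computable_nil].
Qed.

Lemma computable_esp_tasks E (eE : E -> data R) (j : E -> nat) (l : E -> seq (seq R)) :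
  computable eE (@enc_nat R) j -> computable eE (enc_list eV) l ->
  computable eE eR (fun e => esp_tasks nrm perp_seq (j e) (l e)).
Proof.
move=> hj hl; pose eE' := enc_pair (@enc_nat R) (enc_list eV).
suff h : computable eE' eR (fun e => esp_tasks nrm perp_seq e.1 e.2).
  by apply: (computable_comp2 (eA := @enc_nat R) (eB := enc_list eV)
    (F := fun j S => esp_tasks nrm perp_seq j S)).
rewrite /esp_tasks.
apply: (computable_foldl (eB := eT)
  (g := fun a t _ => if t.2.1 != 0%N then a else a + t.1)).
- apply: computable_if; [by apply: testable_neq0; var | by var |].
  by apply: computable_add; var.
- exact: computable_0.
pose step (ts : seq (R * (nat * seq (seq R)))) :=
  flatten [seq split_task nrm perp_seq t | t <- ts].
(* The number of rounds is the length of the list, so the loop runs over that list and ignores its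
   elements. *)
apply: (@computable_ext _ _ _ _ _
  (fun e => foldl (fun ts (_ : seq R) => step ts) [:: (1, e)] e.2)).
  by move=> [j' S] /=; elim: S [:: _] => //= u S IH ts; rewrite IH -iterSr.
apply: (computable_foldl (eA := enc_list eT) (eB := eV) (g := fun ts _ _ => step ts)).
- apply: (computable_comp (eA := enc_list eT) (g := step)); first by var.
  apply: computable_flatten.
  apply: (computable_map (eB := eT) (f := fun t _ => split_task nrm perp_seq t)); last by var.
  by apply: (computable_comp (eA := eT) _ computable_split_task); var.
- apply: computable_cons; last exact: computable_nil.
  by apply: computable_pair; [exact: computable_1 | var].
- by var.
Qed.

Lemma computable_tuples :
  computable (enc_pair (@enc_nat R) (enc_list eV)) (enc_list (enc_list eV))
    (fun x => tuples x.2 (x.1 + x.1)).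
Proof.
pose g (L : seq (seq (seq R))) (x : nat * seq (seq R)) :=
  flatten [seq [seq v :: W | v <- x.2] | W <- L].
(* The k + k rounds are run as k rounds twice, with the unary [k] as counter. *)
apply: (@computable_ext _ _ _ _ _
  (fun x => iter x.1 (fun L => g L x) (iter x.1 (fun L => g L x) [:: [::]]))).
  by move=> x; rewrite /tuples iterD.
have hg : computable
    (enc_pair (enc_list (enc_list eV)) (enc_pair (@enc_nat R) (enc_list eV)))
    (enc_list (enc_list eV)) (fun x => g x.1 x.2).
  apply: computable_flatten.
  apply: (computable_map (eB := enc_list eV)
    (f := fun W (x : seq (seq (seq R)) * (nat * seq (seq R))) => [seq v :: W | v <- x.2.2]));
    last by var.
  apply: (computable_map (eB := eV) (f := fun v
     (x : seq (seq R) * (seq (seq (seq R)) * (nat * seq (seq R)))) => v :: x.1)); last by var.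
  by apply: computable_cons; var.
apply: (computable_iter hg); last by var.
apply: (computable_iter hg); last by var.
by apply: computable_cons; exact: computable_nil.
Qed.

Lemma computable_select :
  computable (enc_pair (@enc_nat R) (enc_list eV)) (enc_list eV)
    (fun x => select nrm perp_seq x.1 x.2).
Proof.
rewrite /select; apply: computable_snd.
pose imp (st : nat * seq (seq R)) (x : nat * seq (seq R)) :=
  (st.1.+1, improve nrm perp_seq (tuples x.2 (x.1 + x.1)) st.1 st.2).
apply: (computable_iter (eA := enc_pair (@enc_nat R) (enc_list eV)) (g := imp)).
- apply: computable_pair; first by apply: computable_succ; var.
  pose F (b S' : seq (seq R)) (j : nat) :=
    if esp_tasks nrm perp_seq j S' <= esp_tasks nrm perp_seq j b then b else S'.
  apply: (computable_foldl (eB := enc_list eV)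
    (g := fun b S' (x : (nat * seq (seq R)) * (nat * seq (seq R))) => F b S' x.1.1)).
  + apply: computable_if; [|by var|by var].
    by apply: testable_le; apply: computable_esp_tasks; var.
  + by var.
  + by apply: (computable_comp _ computable_tuples); var.
- apply: computable_pair; first exact: computable_0nat.
  by apply: computable_head => //; exact: computable_tuples.
- by apply: computable_succ; var.
Qed.

Lemma select_program :
  exists p, forall d k (V : seq 'cV[R]_d),
    run p (enc_input k V) (enc_vecs (select (@sqn R d) (fun u s => perp u *m s) k V)).
Proof.
pose eI := enc_pair (@enc_nat_num R) (enc_pair (@enc_nat_num R) (enc_list eV)).
have [p hp] : computable eI (enc_list eV) (fun x => select nrm perp_seq x.2.1 x.2.2).
  apply: (computable_comp2 (eA := @enc_nat R) (eB := enc_list eV)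
    (F := fun k V => select nrm perp_seq k V)); first exact: computable_select.
    by apply: computable_nat_of_num; var.
  by var.
have vecsE d (W : seq 'cV[R]_d) : enc_vecs W = enc_list eV [seq entries v | v <- W].
  rewrite /enc_vecs /enc_list -map_comp; congr enc_seq; apply: eq_map => v.
  by rewrite /enc_vec /= /entries -map_comp.
exists p => d k V; have := hp (d, (k, [seq entries v | v <- V])).
rewrite vecsE -(@select_map _ _ _ (@entries d) _ nrm _ perp_seq) /=; last 2 first.
- by move=> u; rewrite dot_entries.
- exact: perp_entries.
by rewrite /eI /enc_pair /= -vecsE.
Qed.
End Program.

(** * Lower bound *)

Section LowerBound.
Variable R : realType.

(** In a full-rank factorization P = C D, idempotence forces D C = 1, and the trace is cyclic. *)
Lemma mxrank_idem_trace n (P : 'M[R]_n) : P *m P = P -> (\rank P)%:R = \tr P.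
Proof.
move=> Pi; have /row_fullP[C' hC] := col_base_full P.
have /row_freeP[R' hR] := row_base_free P.
move: (col_base P) (row_base P) (mulmx_base P) hC hR => C D hP hC hR.
have hDC : D *m C = 1%:M.
  transitivity (C' *m (C *m D *m (C *m D)) *m R').
    by rewrite !mulmxA hC mul1mx -mulmxA hR mulmx1.
  have -> : C *m D *m (C *m D) = C *m D by rewrite hP.
  by rewrite mulmxA hC mul1mx hR.
by rewrite -[in RHS]hP mxtrace_mulC hDC mxtrace1.
Qed.

Lemma card_fset_uniq (T : choiceType) (s : seq T) :
  uniq s -> #|` [fset x in s]%fset| = size s.
Proof.
by move=> us; apply: perm_size; apply: uniq_perm => // x; rewrite ?inE.
Qed.

Lemma card_fset_le (T : choiceType) (s : seq T) : (#|` [fset x in s]%fset| <= size s)%N.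
Proof.
apply: leq_trans (size_undup s); apply: uniq_leq_size (fset_uniq _) _ => x.
by rewrite inE mem_undup.
Qed.

(** Testing the order against [P] bounds [sqn (P *m v)] by an average over [U]. A projection that
    sees [v] but hardly any other vector thus forces [v] into [U]. *)
Lemma spanner_proj_le d k (V U : {fset 'cV[R]_d}) alpha c v P :
  spectral_spanner alpha k V U -> v \in V ->
  orth_projection P -> \rank P = (d - k + 1)%N ->
  (forall u, u \in U -> alpha * sqn (P *m u) <= c) -> sqn (P *m v) <= c.
Proof.
move=> [_ hU] vV [Pt Pi] Pr hc; have [mu [mu0 mu1] le] := hU v vV.
have := le P (conj Pt Pi) Pr; rewrite /mxdot Pt trace_rank1 // => h.
apply: le_trans h _; rewrite -scalemxAl mxtraceZ /second_moment mulmx_suml raddf_sum.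
rewrite mulr_sumr -[leRHS]mul1r -mu1 mulr_suml !(big_seq_cond xpredT).
apply: ler_sum => u; rewrite andbT => uU.
rewrite /= -scalemxAl mxtraceZ trace_rank1 // mulrCA.
by rewrite ler_wpM2l ?mu0 ?hc.
Qed.

(** From exp(-x) >= 1 - x at x = t - 2 t^2, since (1 + t)(1 - t + 2 t^2) = 1 + t^2 (1 + 2 t) is at
    least 1. *)
Lemma expR_sub_sqr_le (t : R) : - 2^-1 <= t -> expR (t - 2 * t ^+ 2) <= 1 + t.
Proof.
move=> ht; have := expR_ge1Dx (- (t - 2 * t ^+ 2)).
rewrite expRN => h; set e := expR _ in h *.
have e0 : 0 < e by exact: expR_gt0.
have : e * (1 + - (t - 2 * t ^+ 2)) <= 1.
  by rewrite mulrC -ler_pdivlMr // div1r.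
have hq : 1 <= (1 + t) * (1 - t + 2 * t ^+ 2).
  have : 0 <= t ^+ 2 * (1 + 2 * t) by rewrite mulr_ge0 ?sqr_ge0 //; lra.
  by rewrite !expr2; nra.
have p0 : 0 < 1 - t + 2 * t ^+ 2.
  have := sqr_ge0 (4 * t - 1); rewrite !expr2; nra.
move=> h2; rewrite -(ler_pM2r p0); apply: le_trans hq; apply: le_trans h2.
by rewrite le_eqVlt; apply/orP; left; apply/eqP; ring.
Qed.

(** * Packings of the sign cube *)

Section Packing.
Variable k : nat.
Local Notation cube := {ffun 'I_k -> bool}.
Implicit Types x y : cube.

Definition sgn_dot x y : R := \sum_i (-1) ^+ (x i (+) y i).

(** The sum factors over the coordinates, each contributing (1 + delta) + (1 - delta) = 2. *)
Lemma sum_prod_cube x (delta : R) :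
  \sum_(y : cube) \prod_i (1 + delta * (-1) ^+ (x i (+) y i)) = 2 ^+ k.
Proof.
rewrite -(bigA_distr_bigA (fun i b => 1 + delta * (-1) ^+ (x i (+) b))) /=.
rewrite (eq_bigr (fun=> 2)) ?prodr_const ?card_ord // => i _.
by rewrite big_bool /=; case: (x i); rewrite /= ?expr0 ?expr1; ring.
Qed.

Lemma prod_cube_ge x y (delta s : R) : 0 <= delta <= 2^-1 -> s <= sgn_dot x y ->
  expR (delta * s - 2 * k%:R * delta ^+ 2)
    <= \prod_i (1 + delta * (-1) ^+ (x i (+) y i)).
Proof.
move=> /andP[d0 d1] hs.
apply: le_trans (_ : expR (\sum_i (delta * (-1) ^+ (x i (+) y i) - 2 * delta ^+ 2)) <= _).
  rewrite ler_expR big_split /= -mulr_sumr sumr_const card_ord -mulr_natl.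
  rewrite -/(sgn_dot x y) lerD ?ler_wpM2l //.
  by rewrite le_eqVlt; apply/orP; left; apply/eqP; ring.
rewrite expR_sum; apply: ler_prod => i _; rewrite expR_ge0 /=.
have := @expR_sub_sqr_le (delta * (-1) ^+ (x i (+) y i)).
rewrite exprMn sqrr_sign mulr1; apply.
by case: (_ (+) _); rewrite ?expr0 ?expr1; lra.
Qed.

Lemma prod_cube_ge0 x y (delta : R) : 0 <= delta <= 2^-1 ->
  0 <= \prod_i (1 + delta * (-1) ^+ (x i (+) y i)).
Proof.
move=> /andP[d0 d1]; apply: prodr_ge0 => i _.
by case: (_ (+) _); rewrite ?expr0 ?expr1; lra.
Qed.

(* Chernoff's method, with the weights [1 +- delta] in place of exponentials. *)
Lemma card_far_le x (s : R) : 0 <= s -> s <= k%:R -> (0 < k)%N ->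
  #|[set y | s <= `|sgn_dot x y|]|%:R * expR (s ^+ 2 / (8 * k%:R)) <= 2 * 2 ^+ k.
Proof.
move=> s0 sk k0; have kp : 0 < k%:R :> R by rewrite ltr0n.
(* This [delta] maximises [delta * s - 2 * k%:R * delta ^+ 2]; the maximum is the exponent in the
   claim. *)
pose delta := s / (4 * k%:R).
have hd : 0 <= delta <= 2^-1.
  rewrite divr_ge0 ?mulr_ge0 ?ler0n //= /delta ler_pdivrMr ?mulr_gt0 //; lra.
have eE : s ^+ 2 / (8 * k%:R) = delta * s - 2 * k%:R * delta ^+ 2.
  by rewrite /delta; field; rewrite gt_eqF.
(* Negating [x] flips the sign of [sgn_dot], so the lower tail is the upper tail for [nx]. *)
pose nx := [ffun i => ~~ x i] : cube.
have nxE y : sgn_dot nx y = - sgn_dot x y.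
  rewrite /sgn_dot -sumrN; apply: eq_bigr => i _; rewrite ffunE addNb.
  by case: (_ (+) _); rewrite /= ?expr0 ?expr1 ?opprK.
have -> : 2 * 2 ^+ k = 2 ^+ k + 2 ^+ k :> R by rewrite mulr_natl mulr2n.
rewrite mulr_natl -sumr_const -{1}(sum_prod_cube x delta) -(sum_prod_cube nx delta).
rewrite -big_split /=.
rewrite big_mkcond /=; apply: ler_sum => y _; rewrite inE.
case: ifP => [|_]; last by rewrite addr_ge0 ?prod_cube_ge0.
rewrite ler_normr => /orP[h|h]; rewrite eE.
  apply: le_trans (prod_cube_ge hd h) _; rewrite lerDl; exact: prod_cube_ge0.
rewrite -nxE in h; apply: le_trans (prod_cube_ge hd h) _.
rewrite lerDr; exact: prod_cube_ge0.
Qed.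

(* Gilbert-Varshamov: the balls around a maximal packing cover the cube. *)
Lemma exists_packing (s : R) : 0 <= s -> s <= k%:R -> (0 < k)%N ->
  exists A : {set cube},
    {in A &, forall x y, x != y -> `|sgn_dot x y| < s} /\
    expR (s ^+ 2 / (8 * k%:R)) <= 2 * #|A|%:R.
Proof.
move=> s0 sk k0.
pose good (A : {set cube}) := [forall x in A, forall y in A, (x != y) ==> (`|sgn_dot x y| < s)].
have good0 : good set0 by apply/forall_inP => x; rewrite inE.
have [A /maxsetP[gA maxA] _] := maxset_exists good0.
have gAP x y : x \in A -> y \in A -> x != y -> `|sgn_dot x y| < s.
  by move=> xA yA; move/forall_inP: gA => /(_ _ xA) /forall_inP/(_ _ yA)/implyP; apply.
exists A; split=> //.
have sgnC x y : sgn_dot x y = sgn_dot y x.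
  by apply: eq_bigr => i _; rewrite addbC.
have cover : [set: cube] \subset \bigcup_(x in A) [set y | s <= `|sgn_dot x y|].
  (* A point of [A] lies in its own ball because s <= k; any other uncovered point could be added to
     [A]. *)
  apply/subsetP => y _; have [yA|yA] := boolP (y \in A).
    apply/bigcupP; exists y => //; rewrite inE /sgn_dot.
    under eq_bigr do rewrite addbb expr0.
    by rewrite sumr_const card_ord normr_nat.
  apply: contraT => /bigcupP ncov.
  have near x : x \in A -> `|sgn_dot x y| < s.
    by move=> xA; rewrite ltNge; apply/negP => h; apply: ncov; exists x; rewrite ?inE.
  have /maxA : good (y |: A).
    apply/forall_inP => x; rewrite !inE => /orP[/eqP->|xA]; apply/forall_inP => z;
      rewrite !inE => /orP[/eqP->|zA]; apply/implyP => // neq.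
    - by rewrite eqxx in neq.
    - by rewrite sgnC near.
    - exact: near.
    - exact: gAP.
  by move=> /(_ (subsetUr _ _)) h; rewrite -h setU11 in yA.
have := subset_leq_card cover; rewrite cardsT card_ffun card_bool card_ord => hc.
have {}hc : (2 ^ k <= \sum_(x in A) #|[set y | (s <= `|sgn_dot x y|)%R]|)%N.
  apply: leq_trans hc _; elim/big_rec2: _ => [|x m W _ h]; first by rewrite cards0.
  by apply: leq_trans (leq_card_setU _ _) _; rewrite leq_add2l.
have p2 : 0 < 2 ^+ k :> R by rewrite exprn_gt0.
rewrite -(ler_pM2l p2); set e := expR _.
have : (2 ^ k)%:R * e <= \sum_(x in A) 2 * 2 ^+ k.
  apply: le_trans (_ : (\sum_(x in A) #|[set y | s <= `|sgn_dot x y|]|%:R) * e <= _).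
    by rewrite ler_wpM2r ?expR_ge0 // -natr_sum ler_nat.
  by rewrite mulr_suml; apply: ler_sum => x _; exact: card_far_le.
by rewrite sumr_const natrX => h; apply: le_trans h _; rewrite -[leLHS]mulr_natr mulrAC mulrC.
Qed.


Definition sign_vec m x : 'cV[R]_(k + m) := col_mx (\col_i (-1) ^+ (x i)) 0.

(** Projects onto the span of the sign vector of [x] and the last [m] coordinates, of dimension m +
    1 = d - k + 1 when d = k + m. *)
Definition sign_proj m x : 'M[R]_(k + m) :=
  let w := \col_i (-1) ^+ (x i) in block_mx (k%:R^-1 *: (w *m w^T)) 0 0 1%:M.

Lemma sgn_dotE x y :
  (\col_i (-1) ^+ (x i))^T *m (\col_i (-1) ^+ (y i)) = (sgn_dot x y)%:M.
Proof.
rewrite [LHS]mx11_scalar mxE; congr (_%:M); apply: eq_bigr => i _.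
by rewrite !mxE signr_addb.
Qed.

Lemma sgn_dot_self x : sgn_dot x x = k%:R.
Proof.
rewrite /sgn_dot; under eq_bigr do rewrite addbb expr0.
by rewrite sumr_const card_ord.
Qed.

Lemma sign_vec_inj m : injective (sign_vec m).
Proof.
move=> x y /eq_col_mx[/matrixP h _]; apply/ffunP => i.
by have := h i 0; rewrite !mxE => /(@signr_inj R).
Qed.

Lemma sign_projP m x : (0 < k)%N ->
  orth_projection (sign_proj m x) /\ \rank (sign_proj m x) = m.+1.
Proof.
move=> k0; have kn : k%:R != 0 :> R by rewrite pnatr_eq0 -lt0n.
rewrite /sign_proj /=; set w := \col_i _.
have ww : w^T *m w = k%:R%:M by rewrite sgn_dotE sgn_dot_self.
have hi : k%:R^-1 *: (w *m w^T) *m (k%:R^-1 *: (w *m w^T)) = k%:R^-1 *: (w *m w^T) :> 'M[R]_k.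
  rewrite -scalemxAl -scalemxAr scalerA mulmxA -[w *m w^T *m w]mulmxA ww.
  by rewrite mul_mx_scalar -scalemxAl scalerA -mulrA mulVf // mulr1.
set P := block_mx _ _ _ _.
have Pi : P *m P = P.
  by rewrite /P mulmx_block !(mulmx0, mul0mx, mulmx1, addr0, add0r) hi.
split.
  split=> //; rewrite /P tr_block_mx !trmx0 trmx1 linearZ /= trmx_mul trmxK //.
apply/eqP; rewrite -(eqr_nat R) mxrank_idem_trace // /P mxtrace_block mxtrace1.
by rewrite mxtraceZ mxtrace_mulC ww mxtrace_scalar mulr1n mulVf // addrC natr1.
Qed.

Lemma sign_proj_vec m x y : (0 < k)%N ->
  sqn (sign_proj m x *m sign_vec m y) = sgn_dot x y ^+ 2 / k%:R.
Proof.
move=> k0; have kn : k%:R != 0 :> R by rewrite pnatr_eq0 -lt0n.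
have [[Pt Pi] _] := sign_projP m x k0.
rewrite /sqn trmx_mul Pt mulmxA -[_ *m _ *m sign_proj m x]mulmxA Pi -mulmxA.
rewrite /sign_proj /sign_vec /= mul_block_col !(mulmx0, mul0mx, addr0).
rewrite tr_col_mx mul_row_col mulmx0 addr0 -scalemxAl -scalemxAr.
rewrite -mulmxA sgn_dotE mulmxA sgn_dotE mul_scalar_mx.
rewrite !mxE eqxx !mulr1n.
have -> : sgn_dot y x = sgn_dot x y by apply: eq_bigr => i _; rewrite addbC.
by rewrite mulrC expr2.
Qed.
End Packing.

(** * Sets without proper spanners, for small and large exponents *)

Lemma card_imset_fset (T : finType) (T' : choiceType) (A : {set T}) (f : T -> T') :
  injective f -> #|` [fset v in [seq f x | x <- enum A]]%fset| = #|A|.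
Proof.
by move=> fi; rewrite card_fset_uniq ?map_inj_uniq ?enum_uniq // size_map cardE.
Qed.

(** Under [sign_proj m x] the vector of [x] keeps squared norm k, while every other has at most s^2
    / k = k^eps / 4; the factor k^(1 - eps) raises this only to k / 4. *)
Lemma lower_bound_le1 (eps : R) d k : eps <= 1 -> (0 < k <= d)%N ->
  64 <= k%:R `^ eps ->
  exists V : {fset 'cV[R]_d},
    expR (64^-1 * k%:R `^ eps) <= #|` V|%:R /\
    forall U : {fset 'cV[R]_d},
      spectral_spanner (k%:R `^ (1 - eps)) k V U -> U = V.
Proof.
move=> e1 /andP[k0 kd] hk.
have kp : 0 < k%:R :> R by rewrite ltr0n.
have k1 : 1 <= k%:R :> R by rewrite ler1n.
have kn : k%:R != 0 :> R by rewrite gt_eqF.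
pose s := k%:R `^ ((1 + eps) / 2) / 2 : R.
have hs2 : s ^+ 2 = k%:R * k%:R `^ eps / 4.
  rewrite /s exprMn -powR_mulrn ?powR_ge0 // -powRrM.
  have -> : (1 + eps) / 2 * 2%:R = 1 + eps by field.
  by rewrite powRD ?kn ?implybT // powRr1 ?ltW // exprVn -natrX.
have s0 : 0 <= s by rewrite divr_ge0 ?powR_ge0.
have sk : s <= k%:R.
  have : k%:R `^ ((1 + eps) / 2) <= k%:R `^ 1 :> R by apply: ler_powR => //; lra.
  rewrite powRr1 ?(ltW kp) // => h; apply: le_trans h.
  by rewrite ler_pdivrMr // ler_peMr ?powR_ge0 // ler1n.
have [A [hA cA]] := @exists_packing k s s0 sk k0.
have [m dE] : exists m, d = (k + m)%N by exists (d - k)%N; rewrite subnKC.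
subst d; pose V := [fset v in [seq sign_vec m x | x <- enum A]]%fset.
exists V; split.
  rewrite card_imset_fset; last exact: sign_vec_inj.
  set q := k%:R `^ eps in hk hs2 *.
  have h1 : s ^+ 2 / (8 * k%:R) = 64^-1 * q + 64^-1 * q by rewrite hs2; field.
  move: cA; rewrite h1 expRD => h2.
  (* Half of the exponent k^eps / 32 absorbs the factor 2 of the packing bound, as [hk] makes that
     half at least 1. *)
  have h3 : 2 <= expR (64^-1 * q) by apply: le_trans (expR_ge1Dx _); lra.
  have h4 := expR_gt0 (64^-1 * q); nra.
move=> U hU; apply/eqP; rewrite eqEfsubset hU.1 /=; apply/fsubsetP => v vV.
apply: contraT => vU; move: (vV); rewrite inE => /mapP[x]; rewrite mem_enum => xA vE.
have [Po Pr] := sign_projP m x k0.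
have := @spanner_proj_le _ _ _ _ _ (k%:R / 4) _ (sign_proj m x) hU vV Po.
rewrite vE sign_proj_vec // sgn_dot_self.
have -> : k%:R ^+ 2 / k%:R = k%:R :> R by rewrite expr2 mulfK.
rewrite Pr => h; suff : k%:R <= k%:R / 4 :> R by lra.
apply: h => [|u uU]; first by lia.
move: ((fsubsetP hU.1) u uU); rewrite inE => /mapP[y]; rewrite mem_enum => yA uE.
rewrite uE sign_proj_vec //.
have xy : x != y by apply: contraNneq vU => xy; rewrite vE xy -uE.
have hlt : sgn_dot x y ^+ 2 <= s ^+ 2.
  by rewrite -[leLHS]real_normK ?num_real // lerXn2r ?nnegrE // ltW // hA.
apply: le_trans (_ : k%:R `^ (1 - eps) * (s ^+ 2 / k%:R) <= _).
  by rewrite ler_wpM2l ?powR_ge0 // ler_wpM2r // invr_ge0 ltW.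
rewrite hs2 le_eqVlt; apply/orP; left; apply/eqP.
have hk1 : k%:R `^ (1 - eps) * k%:R `^ eps = k%:R :> R.
  by rewrite -powRD ?kn ?implybT // subrK powRr1 // ltW.
transitivity (k%:R `^ (1 - eps) * k%:R `^ eps / 4 : R); first by field.
by rewrite hk1.
Qed.

(** The factor is below 1, so the longest of finitely many multiples of one vector cannot be
    dominated. No spanner exists, and [V] may be as large as desired. *)
Lemma lower_bound_gt1 (eps : R) d k : 1 < eps -> (1 < k <= d)%N ->
  exists V : {fset 'cV[R]_d},
    expR (64^-1 * k%:R `^ eps) <= #|` V|%:R /\
    forall U : {fset 'cV[R]_d},
      spectral_spanner (k%:R `^ (1 - eps)) k V U -> U = V.
Proof.
move=> e1 /andP[k1 kd]; case: d kd => [|d] kd; first by lia.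
set a := k%:R `^ (1 - eps); set t := expR _.
have a0 : 0 <= a by exact: powR_ge0.
have a1 : a < 1.
  rewrite /a /powR pnatr_eq0 eqn0Ngt (ltnW k1) /= -[ltRHS](@expR0 R) ltr_expR.
  by rewrite pmulr_llt0 ?subr_lt0 // ln_gt0 // ltr1n.
have [N tN N0] : exists2 N, t < N%:R & (0 < N)%N.
  by exists (Num.truncn t).+1; rewrite ?truncnS_gt.
pose f (i : nat) : 'cV[R]_d.+1 := i.+1%:R *: delta_mx 0 0.
have fi : injective f.
  move=> i j /matrixP/(_ 0 0); rewrite !mxE !eqxx !mulr1 => /eqP.
  by rewrite eqr_nat eqSS => /eqP.
exists [fset v in [seq f i | i <- iota 0 N]]%fset; split.
  by rewrite card_fset_uniq ?map_inj_uniq ?iota_uniq // size_map size_iota ltW.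
move=> U hU; exfalso.
(* This [P] fixes the first basis vector, hence every element of [V]. *)
pose P : 'M[R]_d.+1 := pid_mx (d.+1 - k + 1).
have Po : orth_projection P.
  by split; rewrite /P ?tr_pid_mx // pid_mx_id //; lia.
have Pr : \rank P = (d.+1 - k + 1)%N by rewrite rank_pid_mx //; lia.
have Pf i : sqn (P *m f i) = i.+1%:R ^+ 2.
  have -> : P *m f i = f i.
    rewrite /f -scalemxAr; congr (_ *: _); apply/matrixP => r c; rewrite !mxE.
    rewrite (bigD1 0) //= big1 => [|l l0]; last by rewrite !mxE (negPf l0) mulr0.
    rewrite !mxE addr0 [c]ord1 !eqxx mulr1 andbT.
    have [->|r0] := eqVneq r 0; first by rewrite eqxx addn1.
    by have := r0; rewrite -val_eqE => /negPf->.
  rewrite sqnZ sqnE (bigD1 0) //= big1 => [|l l0].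
    by rewrite mxE !eqxx expr1n addr0 mulr1.
  by rewrite mxE (negPf l0) expr0n.
have := @spanner_proj_le _ _ _ _ _ (a * N%:R ^+ 2) (f N.-1) P hU _ Po Pr.
rewrite Pf prednK // => h; suff : N%:R ^+ 2 <= a * N%:R ^+ 2.
  apply/negP; rewrite -ltNge -[ltRHS]mul1r ltr_pM2r // exprn_gt0 // ltr0n //.
apply: h => [|u uU]; first by rewrite inE map_f // mem_iota /= prednK.
move: ((fsubsetP hU.1) u uU); rewrite inE => /mapP[i]; rewrite mem_iota => /andP[_ iN] ->.
by rewrite Pf ler_wpM2l // lerXn2r ?nnegrE ?ler0n // ler_nat.
Qed.
End LowerBound.

Theorem theorem1p2 (R : realType) :
  (exists C c : R,
    [/\ 0 < C,
        0 < c,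
        exists p : prog,
          forall (d k : nat) (V : seq 'cV[R]_d), (1 <= k <= d)%N ->
          exists U : seq 'cV[R]_d,
            [/\ run p (enc_input k V) (enc_vecs U),
                spectral_spanner (quasilin C c k) k
                  [fset v in V]%fset [fset u in U]%fset
              & (size U)%:R <= quasilin C c k]
      & forall (d k : nat) (V : {fset 'cV[R]_d}), (1 <= k <= d)%N ->
          exists U : {fset 'cV[R]_d},
            spectral_spanner (quasilin C c k) k V U /\
            (#|` U|)%:R <= quasilin C c k])
  /\
  (forall eps : R, 0 < eps ->
    exists (c' : R) (k0 : nat), 0 < c' /\
      forall d k : nat, (1 <= k)%N -> (k0 <= k <= d)%N ->
      exists V : {fset 'cV[R]_d},
        expR (c' * k%:R `^ eps) <= (#|` V|)%:R /\
        forall U : {fset 'cV[R]_d},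
          spectral_spanner (k%:R `^ (1 - eps)) k V U -> U = V).
Proof.
split.
  (* The factor is 8k and the size at most 2k, while 1 + ln k is at least 1. *)
  exists 8, 1.
  have ql k : (1 <= k)%N -> 8 * k%:R <= quasilin (8 : R) 1 k.
    move=> k1; have lk : 0 <= ln (k%:R : R) by rewrite ln_ge0 // ler1n.
    rewrite /quasilin powRr1 ?addr_ge0 // ler_peMr ?mulr_ge0 //; lra.
  have main d k (V : seq 'cV[R]_d) : (1 <= k <= d)%N ->
      let U := select (@sqn R d) (fun u s => perp u *m s) k V in
      spectral_spanner (quasilin 8 1 k) k [fset v in V]%fset [fset u in U]%fset /\
      (size U)%:R <= quasilin (8 : R) 1 k.
    move=> hkd U; have /andP[k1 _] := hkd.
    have [V0|V0] := eqVneq V [::].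
      have UE : U = [::] by rewrite /U V0 select_nil.
      rewrite UE; split; last by apply: le_trans (ql k k1); rewrite mulr_ge0.
      split=> [|v]; last by rewrite V0 inE.
      by apply/fsubsetP => u; rewrite inE.
    have [sU UV dU] := select_dominant k V0; split.
      exact: spectral_spanner_dominant (ql k k1).
    rewrite sU; apply: le_trans (ql k k1); rewrite -muln2 natrM mulrC.
    by rewrite ler_wpM2r ?ler0n // ler_nat.
  have [p hp] := select_program R.
  split=> // [|d k V hkd].
    exists p => d k V hkd.
    exists (select (@sqn R d) (fun u s => perp u *m s) k V).
    by have [h1 h2] := main d k V hkd; split.
  have [h1 h2] := main d k V hkd.
  have fE (s : seq 'cV[R]_d) : s =i V -> [fset v in s]%fset = V.
    by move=> sV; apply/fsetP => v; rewrite inE sV.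
  rewrite (fE (enum_fset V)) // in h1.
  exists [fset u in select (@sqn R d) (fun u s => perp u *m s) k V]%fset; split=> //.
  apply: le_trans h2; rewrite ler_nat; exact: card_fset_le.
move=> eps e0.
(* Beyond 64^(1/eps) one has k^eps >= 64; the second successor ensures k >= 2 for
   [lower_bound_gt1]. *)
exists 64^-1, (Num.truncn ((64 : R) `^ eps^-1)).+2; split=> [|d k k1 /andP[hk kd]].
  by rewrite invr_gt0.
have hk64 : 64 <= k%:R `^ eps :> R.
  have -> : (64 : R) = (64 `^ eps^-1) `^ eps.
    by rewrite -powRrM mulVf ?gt_eqF // powRr1.
  apply: ge0_ler_powR; rewrite ?nnegrE ?powR_ge0 ?ler0n ?ltW //.
  apply: lt_le_trans (truncnS_gt _) _; rewrite ler_nat; exact: ltnW hk.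
have [e1|e1] := leP eps 1; first by apply: lower_bound_le1; rewrite // k1.
by apply: lower_bound_gt1; rewrite // kd andbT; lia.
Qed.
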